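(* Let $\mathcal K$ be a nonsingular conic in the complex projective plane, and let $\Gamma=\{A,B,C,D,E,F\}$ be a set of six distinct points on $\mathcal K$. Then the following statements are equivalent: (1) $\Gamma$ is tri-involutive. (2) $\Gamma$ satisfies Cayley-Salmon conjugacy (CSC).
   Context: The base field is $\mathbf C$. Fix an isomorphism $\mathcal K\simeq\mathbf P^1$. Tri-involutive: a set $\Gamma$ of six distinct points of $\mathcal K\simeq \mathbf P^1$ is tri-involutive if it is projectively equivalent (under an automorphism of $\mathbf P^1$) to $\{0,1,\infty,p,\frac{p-1}{p},\frac{1}{1-p}\}$ for some $p\in\mathbf P^1$. (Distinctness of the points forces $p\ne 0,1,\infty,\frac{1\pm\sqrt{-3}}{2}$.) Pascal lines: arrange the six points as an array $\left[\begin{smallmatrix} A & B & C \\ F & E & D \end{smallmatrix}\right]$. By Pascal's theorem the three points $AE\cap BF$, $AD\cap CF$, $BD\cap CE$ are collinear; the line containing them is the Pascal of the array. Equivalently, it is the Pascal line of the hexagon with consecutive vertices $A,E,C,F,B,D$ (the line containing the three intersection points of opposite sides). There are $60$ Pascals, one for each hexagon on the six points. Labelling: let $\mathrm{SIX}=\{1,\dots,6\}$. Associate to each pair of letters a partition of $\mathrm{SIX}$ into three pairs as follows: $AB: 14.25.36$; $AC: 16.24.35$; $AD: 13.26.45$; $AE: 12.34.56$; $AF: 15.23.46$; $BC: 15.26.34$; $BD: 12.35.46$; $BE: 16.23.45$; $BF: 13.24.56$; $CD: 14.23.56$; $CE: 13.25.46$; $CF: 12.36.45$; $DE: 15.24.36$;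 $DF: 16.25.34$; $EF: 14.26.35$. For distinct $x,y,z\in\mathrm{SIX}$, the six pairs of letters whose associated partition contains $xy$ or $xz$ are the sides of a hexagon on $\{A,\dots,F\}$, and $k(x,yz)=k(x,zy)$ denotes the Pascal line of that hexagon. For instance $k(1,23)$ is the Pascal of $\left[\begin{smallmatrix} A & B & C \\ F & E & D \end{smallmatrix}\right]$, $k(2,13)$ that of $\left[\begin{smallmatrix} A & B & C \\ D & F & E \end{smallmatrix}\right]$, and $k(3,12)$ that of $\left[\begin{smallmatrix} A & B & C \\ E & D & F \end{smallmatrix}\right]$. Kirkman points: for $w\in\mathrm{SIX}$ and a $3$-element set $\{x,y,z\}\subseteq\mathrm{SIX}\setminus\{w\}$, the lines $k(w,xy),k(w,xz),k(w,yz)$ are concurrent (Kirkman), and their common point is the Kirkman point $K[w,xyz]$. Cayley-Salmon lines: for a $3$-element subset $\{x,y,z\}\subseteq\mathrm{SIX}$, the three Kirkman points $K[w,xyz]$, $w\in\mathrm{SIX}\setminus\{x,y,z\}$, are collinear (Cayley and Salmon), and the line containing them is the Cayley-Salmon line $g(xyz)$ (the order of $x,y,z$ is irrelevant). For special $\Gamma$ it may become undefined, namely when these Kirkman points fail to determine a line (for instance when all three coincide); it is defined when at least two of these Kirkman points are well-defined and distinct. Conjugate lines: two lines are conjugate (with respect to $\mathcal K$) if the pole of one with respect to $\mathcal K$ lies on the other. CSC: $\Gamma$ satisfies Cayley-Salmon conjugacy if the lines $g(uvw)$ and $g(xyz)$ are conjugate whenever both are defined and $\{u,v,w,x,y,z\}=\mathrm{SIX}$.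 *)

(* Defs.v *)
From HB Require Import structures.
From mathcomp Require Import all_boot all_order all_algebra.
From mathcomp Require Export reals complex.

Set Implicit Arguments.
Unset Strict Implicit.
Unset Printing Implicit Defensive.

Import GRing.Theory.
Local Open Scope ring_scope.

(* A subspace of dimension 1 (resp. 2) of K^n+1 is a point (resp. a line) of  *)
(* the projective space P^n.  Joins are sums and meets are intersections.     *)

Definition is_point (K : fieldType) n (P : {vspace 'rV[K]_n}) : Prop :=
  \dim P = 1%N.

Inductive letter := A | B | C | D | E | F.

Definition letters : seq letter := [:: A; B; C; D; E; F].

Definition letter_index (l : letter) : nat :=
  match l with A => 0 | B => 1 | C => 2 | D => 3 | E => 4 | F => 5 end.

Lemma letter_indexK : cancel letter_index (nth A letters).
Proof. by case. Qed.

HB.instance Definition _ := Countable.copy letter (can_type letter_indexK).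

Definition SIX : seq nat := [:: 1; 2; 3; 4; 5; 6]%N.

Definition labelling : seq ((letter * letter) * seq (nat * nat)) :=
  [:: ((A, B), [:: (1, 4); (2, 5); (3, 6)]);
      ((A, C), [:: (1, 6); (2, 4); (3, 5)]);
      ((A, D), [:: (1, 3); (2, 6); (4, 5)]);
      ((A, E), [:: (1, 2); (3, 4); (5, 6)]);
      ((A, F), [:: (1, 5); (2, 3); (4, 6)]);
      ((B, C), [:: (1, 5); (2, 6); (3, 4)]);
      ((B, D), [:: (1, 2); (3, 5); (4, 6)]);
      ((B, E), [:: (1, 6); (2, 3); (4, 5)]);
      ((B, F), [:: (1, 3); (2, 4); (5, 6)]);
      ((C, D), [:: (1, 4); (2, 3); (5, 6)]);
      ((C, E), [:: (1, 3); (2, 5); (4, 6)]);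
      ((C, F), [:: (1, 2); (3, 6); (4, 5)]);
      ((D, E), [:: (1, 5); (2, 4); (3, 6)]);
      ((D, F), [:: (1, 6); (2, 5); (3, 4)]);
      ((E, F), [:: (1, 4); (2, 6); (3, 5)])]%N.

Definition contains (s : seq (nat * nat)) (x y : nat) : bool :=
  ((x, y) \in s) || ((y, x) \in s).

(* A hexagon is the cyclic sequence of its six vertices. *)
Definition is_side (h : seq letter) (a b : letter) : bool :=
  (b == next h a) || (a == next h b).

(* The hexagon is unique up to rotation and reversal, neither of which *)
(* affects its Pascal line.                                            *)
Definition hexagon (x y z : nat) : seq letter :=
  head [::] [seq h <- permutations letters |
    all (fun e => is_side h e.1.1 e.1.2 ==
                  (contains e.2 x y || contains e.2 x z)) labelling].

Section Hexagram.
Variables (K : fieldType) (G : letter -> {vspace 'rV[K]_3}).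

Definition pascal (h : seq letter) : {vspace 'rV[K]_3} :=
  if h is [:: a1; a2; a3; a4; a5; a6] then
    (((G a1 + G a2) :&: (G a4 + G a5)) +
     ((G a2 + G a3) :&: (G a5 + G a6)) +
     ((G a3 + G a4) :&: (G a6 + G a1)))%VS
  else 0%VS.

(* The line k(x, yz). *)
Definition pascal_k (x y z : nat) : {vspace 'rV[K]_3} :=
  pascal (hexagon x y z).

(* The point K[w, xyz]; it is undefined when the three lines coincide, and *)
(* the intersection is then not a point.                                   *)
Definition kirkman (w x y z : nat) : {vspace 'rV[K]_3} :=
  (pascal_k w x y :&: pascal_k w x z :&: pascal_k w y z)%VS.

Definition kirkman_defined (w x y z : nat) : Prop :=
  is_point (kirkman w x y z).

Definition cayley_salmon_defined (x y z : nat) : Prop :=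
  exists v w : nat,
    [/\ v \in SIX /\ v \notin [:: x; y; z],
        w \in SIX /\ w \notin [:: x; y; z],
        kirkman_defined v x y z,
        kirkman_defined w x y z
      & kirkman v x y z != kirkman w x y z].

(* The line g(xyz), as the span of the well-defined points K[w, xyz]. *)
Definition cayley_salmon (x y z : nat) : {vspace 'rV[K]_3} :=
  (\sum_(w <- SIX | (w \notin [:: x; y; z]) &&
                    (\dim (kirkman w x y z) == 1%N)) kirkman w x y z)%VS.

End Hexagram.

Section Conic.
Variable K : fieldType.

(* The conic with Gram matrix Q is nonsingular when Q is symmetric and *)
(* invertible.                                                         *)
Definition conic_form (Q : 'M[K]_3) (u v : 'rV[K]_3) : K :=
  (u *m Q *m v^T) 0 0.

Definition nonsingular_conic (Q : 'M[K]_3) : Prop :=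
  Q^T = Q /\ Q \in unitmx.

Definition on_conic (Q : 'M[K]_3) (P : {vspace 'rV[K]_3}) : Prop :=
  is_point P /\ forall v, v \in P -> conic_form Q v v = 0.

(* P is the pole of L: the polar line of P is L. *)
Definition is_pole (Q : 'M[K]_3) (P L : {vspace 'rV[K]_3}) : Prop :=
  is_point P /\
  forall v, v \in L <-> (forall u, u \in P -> conic_form Q u v = 0).

Definition conjugate (Q : 'M[K]_3) (L M : {vspace 'rV[K]_3}) : Prop :=
  exists P, is_pole Q P L /\ (P <= M)%VS.

Definition CSC (Q : 'M[K]_3) (G : letter -> {vspace 'rV[K]_3}) : Prop :=
  forall u v w x y z : nat,
    perm_eq [:: u; v; w; x; y; z] SIX ->
    cayley_salmon_defined G u v w -> cayley_salmon_defined G x y z ->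
    conjugate Q (cayley_salmon G u v w) (cayley_salmon G x y z).

(* Homogeneous coordinates [s : t] on P^1; the point [s : t] has affine *)
(* coordinate s / t, and [1 : 0] is the point at infinity.              *)
Definition hcoord (s t : K) : 'rV[K]_2 := \row_(j < 2) [:: s; t]`_j.

Definition quadratic_map (M : 'M[K]_3) (v : 'rV[K]_2) : 'rV[K]_3 :=
  let s := v 0 0 in let t := v 0 1 in
  \row_(j < 3) [:: s ^+ 2; s * t; t ^+ 2]`_j *m M.

(* [s : t] |-> [s^2 : st : t^2] M is an isomorphism from P^1 onto the conic. *)
(* Every isomorphism is of this form, for it pulls O(1) back to O(2) and its *)
(* coordinates form a basis of the binary quadratic forms.                   *)
Definition conic_isomorphism (Q M : 'M[K]_3) : Prop :=
  M \in unitmx /\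
  forall v, conic_form Q (quadratic_map M v) (quadratic_map M v) = 0.

(* 0, 1, oo, p, (p - 1) / p, 1 / (1 - p) for p = [s : t]; the formulas make *)
(* sense for every p in P^1, p = 0, 1, oo included.                         *)
Definition tri_involutive_model (p : 'rV[K]_2) : seq 'rV[K]_2 :=
  let s := p 0 0 in let t := p 0 1 in
  [:: hcoord 0 1; hcoord 1 1; hcoord 1 0;
      p; hcoord (s - t) s; hcoord t (t - s)].

(* N is the matrix of an automorphism of P^1. *)
Definition tri_involutive (M : 'M[K]_3) (G : letter -> {vspace 'rV[K]_3}) :
    Prop :=
  exists p : 'rV[K]_2, p != 0 /\
  exists N : 'M[K]_2, N \in unitmx /\
    [seq G l | l <- letters] =i
    [seq <[quadratic_map M (v *m N)]>%VS | v <- tri_involutive_model p].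

End Conic.

(* Main.v *)
Require Import Defs.
From mathcomp Require Import all_boot all_order all_algebra.
From mathcomp Require Import reals complex.
From mathcomp Require Import ring.

Set Implicit Arguments.
Unset Strict Implicit.
Unset Printing Implicit Defensive.

Import GRing.Theory Num.Theory.

Local Open Scope ring_scope.

(** The cubics through the six points of [Gamma] map the plane onto a cubic
    surface with a node, to which they contract the conic, and the projection
    from the node gives the plane back.  In Cremona's hexahedral coordinates
    the surface is [sum x_i = sum n_i^2 x_i = sum x_i^3 = 0] in [P^5] and the
    node is the point [n = (n_1, ..., n_6)], so that [sum n_i = sum n_i^3 = 0].
    The [n_i] are Joubert's invariants of the sextuple; distinctness of the
    points amounts to [n_i + n_j <> 0] for [i <> j].

    The whole figure becomes linear in these coordinates, which is what the
    labelling by [SIX] encodes.  The chord with label [ij.kl.mn] is the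
    projection of the line [x_i + x_j = x_k + x_l = x_m + x_n = 0], the Pascal
    [k(x, yz)] that of [x_x + x_y = x_x + x_z = 0], the Kirkman point
    [K[w, xyz]] that of the point [x_w + x_x = x_w + x_y = x_w + x_z = 0], and
    the Cayley-Salmon line [g(xyz)] that of [x_x = x_y = x_z].  So [g(xyz)] is
    the zero set of the linear form
    [(n_y - n_z) x_x + (n_z - n_x) x_y + (n_x - n_y) x_z], and the dual of the
    conic takes on two complementary forms of this kind the value
    [c V(n_u, n_v, n_w) V(n_x, n_y, n_z)], where [V] is the Vandermonde product
    and [c] a nonzero constant ([salmon_polar]).

    Hence, for a splitting of [SIX] into two triples whose lines are defined,
    conjugacy says that two of the [n_i] in one of the blocks are equal.  If
    three of the [n_i] agree, two of them fall in one block, unless all three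
    fill a block; in that case the three Kirkman points of the block coincide
    and its line is undefined ([three_equal_CSC]).  If no value is taken three
    times, sorting the values and dealing them out alternately gives two blocks
    of distinct values, for which both lines are defined and not conjugate
    ([CSC_three_equal]).

    Finally [n_i = n_j] holds exactly when the three chords whose labels
    contain [ij] are concurrent, that is, when the three pairs of points are in
    involution ([eq_joubertP]).  Two such involutions with an index in common
    compose to a map of order three, whose orbits split the sextuple, in a suitable
    coordinate, into [{0, 1, oo}] and [{p, (p - 1) / p, 1 / (1 - p)}]; conversely
    the model has three such involutions ([three_equal_tri_involutive],
    [tri_involutive_three_equal]). *)

(** * Small matrices and subspaces of the plane *)

Lemma mulmx33E (R : pzRingType) m n (X : 'M[R]_(m, 3)) (Y : 'M[R]_(3, n)) i j :
  (X *m Y) i j = X i 0 * Y 0 j + X i 1 * Y 1 j + X i 2%:R * Y 2%:R j.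
Proof.
rewrite mxE !big_ord_recr big_ord0 /= add0r.
by congr (_ * _ + _ * _ + _ * _); congr (_ _ _); apply: val_inj.
Qed.

Lemma ord3_ind (T : 'I_3 -> Prop) : T 0 -> T 1 -> T 2%:R -> forall i, T i.
Proof.
move=> T0 T1 T2 i.
have : (i == 0) || (i == 1) || (i == 2%:R) by case: i => [[|[|[|]]] ?].
by case/orP => [/orP [] | ] /eqP ->.
Qed.

Lemma det2 (R : comPzRingType) (N : 'M[R]_2) : \det N = N 0 0 * N 1 1 - N 0 1 * N 1 0.
Proof.
have [F NE] : exists F : nat -> nat -> R, forall i j, N i j = F i j.
  by exists (fun a b => N (inord a) (inord b)) => i j; rewrite !inord_val.
rewrite (expand_det_col _ 0) !big_ord_recl big_ord0 /cofactor !det_mx11 !mxE.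
by rewrite !NE /= /bump /=; ring.
Qed.

Lemma det3 (R : comPzRingType) (M : 'M[R]_3) : \det M =
  M 0 0 * (M 1 1 * M 2%:R 2%:R - M 2%:R 1 * M 1 2%:R)
  - M 1 0 * (M 0 1 * M 2%:R 2%:R - M 2%:R 1 * M 0 2%:R)
  + M 2%:R 0 * (M 0 1 * M 1 2%:R - M 1 1 * M 0 2%:R).
Proof.
have [F ME] : exists F : nat -> nat -> R, forall i j, M i j = F i j.
  by exists (fun a b => M (inord a) (inord b)) => i j; rewrite !inord_val.
rewrite (expand_det_col _ 0) !big_ord_recl big_ord0 /cofactor.
rewrite !(expand_det_col _ 0) !big_ord_recl !big_ord0 /cofactor !det_mx11 !mxE.
by rewrite !ME /= /bump /=; ring.
Qed.

Lemma vlineZ (K : fieldType) (vT : vectType K) (c : K) (v : vT) :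
  c != 0 -> <[c *: v]>%VS = <[v]>%VS.
Proof.
move=> c0; apply/eqP; rewrite eqEsubv -!memvE memvZ ?memv_line //=.
by rewrite -{1}[v](scalerK c0) memvZ ?memv_line.
Qed.

Section PlaneLines.
Variable K : fieldType.
Implicit Types (u v w : 'rV[K]_3) (a b : 'cV[K]_3) (U V P : {vspace 'rV[K]_3}).

Lemma dim_rV3 : \dim {:'rV[K]_3} = 3%N.
Proof. by rewrite dimvf /= dim_matrix. Qed.

Lemma dimv_le3 U : (\dim U <= 3)%N.
Proof. by have := dimvS (subvf U); rewrite dim_rV3. Qed.

Definition incidence a : 'Hom('rV[K]_3, 'rV[K]_1) := linfun (mulmxr a).

Definition line a : {vspace 'rV[K]_3} := lker (incidence a).

Lemma mem_line a v : (v \in line a) = (v *m a == 0).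
Proof. by rewrite memv_ker lfunE. Qed.

Lemma dim_line_ge2 a : (2 <= \dim (line a))%N.
Proof.
have := limg_ker_dim (incidence a) fullv; rewrite capfv dim_rV3 => h.
have : (\dim (limg (incidence a)) <= 1)%N.
  by apply: leq_trans (dimvS (subvf _)) _; rewrite dimvf /= dim_matrix.
by rewrite -(leq_add2l (\dim (line a))) h addn1.
Qed.

Lemma dim_cap_gt0 U V : (2 <= \dim U)%N -> (2 <= \dim V)%N -> (0 < \dim (U :&: V)%VS)%N.
Proof.
move=> dU dV; rewrite -(ltn_add2l (\dim (U + V)%VS)) dimv_sum_cap addn0.
exact: leq_ltn_trans (dimv_le3 _) (@leq_add 2 2 _ _ dU dV).
Qed.

Lemma meet_lines_neq0 a b : exists2 v : 'rV[K]_3, v != 0 & (v *m a == 0) && (v *m b == 0).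
Proof.
have h : (line a :&: line b)%VS != 0%VS.
  by rewrite -dimv_eq0 -lt0n dim_cap_gt0 ?dim_line_ge2.
exists (vpick (line a :&: line b)); first by rewrite vpick0.
by have := memv_pick (line a :&: line b); rewrite memv_cap !mem_line.
Qed.

(** Testing the inclusion on the vectors [a_j e_i - a_i e_j] suffices. *)
Lemma sub_line_colinear a b :
  a != 0 -> (forall v, v *m a = 0 -> v *m b = 0) -> exists c, b = c *: a.
Proof.
move=> a0 h; have [i ai] : exists i, a i 0 != 0.
  apply/existsP; rewrite -[X in is_true X]negbK negb_exists; apply: contra a0.
  move=> /forallP z; apply/eqP/colP => i; rewrite mxE.
  by have := z i; rewrite negbK => /eqP.
exists (b i 0 / a i 0); apply/colP => j; rewrite mxE.
have hd (k : 'I_3) (c : 'cV[K]_3) : 'e_k *m c = (c k 0)%:M.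
  by apply/rowP => z; rewrite -rowE !mxE ord1 eqxx.
have := h (a j 0 *: 'e_i - a i 0 *: 'e_j).
rewrite !mulmxBl -!scalemxAl !hd => /(_ _)/rowP/(_ 0).
rewrite !mxE /= mulr1n => e; apply: (mulfI ai).
rewrite mulrA [_ * (_ / _)]mulrC divfK // [RHS]mulrC; apply/eqP.
rewrite eq_sym -subr_eq0 e //; apply/rowP => z.
by rewrite !mxE ord1 /= mulr1n mulrC subrr.
Qed.

Lemma dim_line a : a != 0 -> \dim (line a) = 2%N.
Proof.
move=> a0; apply/eqP; rewrite eqn_leq dim_line_ge2 andbT -ltnS.
rewrite ltn_neqAle dimv_le3 andbT; apply: contra a0 => e.
have /eqP h : line a == fullv by rewrite eqEdim subvf /= (eqP e) dim_rV3.
apply/eqP/row_matrixP => i; rewrite row0 rowE; apply/eqP.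
by rewrite -mem_line h memvf.
Qed.

Lemma line_eq U a : a != 0 -> (U <= line a)%VS -> (2 <= \dim U)%N -> U = line a.
Proof. by move=> a0 Ua dU; apply/eqP; rewrite eqEdim Ua dim_line. Qed.

(** The pole of the line with equation [a] is [a^T Q^-1], and it is unique
    because an equation of a line is unique up to a factor. *)
Lemma conjugate_lines (Q : 'M[K]_3) a b : nonsingular_conic Q -> a != 0 ->
  conjugate Q (line a) (line b) <-> (a^T *m invmx Q *m b) 0 0 = 0.
Proof.
move=> [sQ uQ] a0; set p := a^T *m invmx Q.
have pQ : p *m Q = a^T by rewrite mulmxKV.
have formp v : conic_form Q p v = (v *m a) 0 0.
  by rewrite /conic_form pQ -trmx_mul mxE.
have p0 : p != 0.
  by apply: contra a0 => /eqP p0; rewrite -[a]trmxK -pQ p0 mul0mx trmx0 eqxx.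
split=> [[P [[dP polP] Pb]] | e].
  have [c ec] : exists c, Q *m (vpick P)^T = c *: a.
    apply: sub_line_colinear => // v /eqP; rewrite -mem_line => /polP vP.
    apply/rowP => i; rewrite ord1 [RHS]mxE -(vP _ (memv_pick P)) /conic_form.
    have -> : vpick P *m Q *m v^T = (v *m (Q *m (vpick P)^T))^T.
      by rewrite !trmx_mul trmxK sQ.
    by rewrite [RHS]mxE.
  have ep : vpick P = c *: p.
    have h : c *: a^T = vpick P *m Q by rewrite -linearZ -ec /= trmx_mul trmxK sQ.
    by rewrite /p scalemxAl h mulmxK.
  have vP0 : vpick P != 0 by rewrite vpick0 -dimv_eq0 dP.
  have c0 : c != 0 by apply: contraNneq vP0 => c0; rewrite ep c0 scale0r.
  have := subvP Pb _ (memv_pick P); rewrite mem_line ep -scalemxAl.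
  by rewrite scaler_eq0 (negPf c0) => /eqP ->; rewrite mxE.
exists <[p]>%VS; split; last first.
  by rewrite -memvE mem_line; apply/eqP/rowP => i; rewrite ord1 e mxE.
split; first by rewrite /is_point dim_vline p0.
move=> v; rewrite mem_line; split=> [/eqP va u /vlineP [c ->]|h].
  by rewrite /conic_form -2!scalemxAl mxE -/(conic_form Q p v) formp va [X in _ * X]mxE mulr0.
by apply/eqP/rowP => i; rewrite ord1 [RHS]mxE -formp h ?memv_line.
Qed.

End PlaneLines.

(** * The labelling and the hexagons *)

Definition joins (a b : letter) (e : (letter * letter) * seq (nat * nat)) : bool :=
  (e.1 == (a, b)) || (e.1 == (b, a)).

Definition label (a b : letter) : seq (nat * nat) :=
  (nth ((a, b), [::]) labelling (find (joins a b) labelling)).2.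

Lemma label_diag a : label a a = [::].
Proof. by case: a; vm_compute. Qed.

(** One of the labels of [ab] and [cd] contains [xy], the other [xz], and both
    contain a further pair [qr].  Opposite sides of the hexagon of [k(x, yz)] are
    related in this way, and the shared pair puts their meet on the Pascal. *)
Definition meet_on_pascal (x y z : nat) (a b c d : letter) : bool :=
  has (fun q => has (fun r =>
    [&& uniq [:: x; y; z; q; r], contains (label a b) q r, contains (label c d) q r
     & (contains (label a b) x y && contains (label c d) x z) ||
       (contains (label a b) x z && contains (label c d) x y)]) SIX) SIX.

Definition pascal_hexagon (x y z : nat) (h : seq letter) : bool :=
  if h is [:: a1; a2; a3; a4; a5; a6] then
    [&& uniq h, meet_on_pascal x y z a1 a2 a4 a5, meet_on_pascal x y z a2 a3 a5 a6
      & meet_on_pascal x y z a3 a4 a6 a1]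
  else false.

(** Short-circuiting forms of [all] and of the head of a filter, by which the
    hexagons are found without testing all the sides of all 720 arrangements. *)
Fixpoint lazy_all T (p : pred T) (s : seq T) : bool :=
  if s is x :: s' then if p x then lazy_all p s' else false else true.

Lemma lazy_allE T (p : pred T) s : lazy_all p s = all p s.
Proof. by elim: s => //= x s ->; case: (p x). Qed.

Fixpoint first_such T (x0 : T) (p : pred T) (s : seq T) : T :=
  if s is x :: s' then if p x then x else first_such x0 p s' else x0.

Lemma first_suchE T (x0 : T) p s : first_such x0 p s = head x0 (filter p s).
Proof. by elim: s => //= x s ->; case: (p x). Qed.

(** All that Pascals need from the labelling: for each of the 120 triples
    the hexagon exists, and its opposite sides share a pair of indices. *)
Lemma hexagon_pascal x y z : x \in SIX -> y \in SIX -> z \in SIX -> uniq [:: x; y; z] ->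
  pascal_hexagon x y z (hexagon x y z).
Proof.
have H : let hexes := permutations letters in
  all (fun x => all (fun y => all (fun z =>
  if uniq [:: x; y; z] then pascal_hexagon x y z
    (let sides := [seq (e.1, contains e.2 x y || contains e.2 x z) | e <- labelling] in
     first_such [::]
     (fun h => lazy_all (fun e => is_side h e.1.1 e.1.2 == e.2) sides)
     hexes)
   else true) SIX) SIX) SIX.
  by vm_compute.
cbv zeta in H => xS yS zS u.
move: (allP (allP (allP H x xS) y yS) z zS); rewrite {H} u first_suchE /hexagon.
have -> // : filter (fun h => lazy_all (fun e => is_side h e.1.1 e.1.2 == e.2)
    [seq (e.1, contains e.2 x y || contains e.2 x z) | e <- labelling])
    (permutations letters) = [seq h <- permutations letters |
    all (fun e => is_side h e.1.1 e.1.2 == (contains e.2 x y || contains e.2 x z))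
      labelling].
by apply: eq_filter => h; rewrite lazy_allE all_map.
Qed.

Definition syntheme (i j : nat) : seq (letter * letter) :=
  [seq e.1 | e <- labelling & contains e.2 i j].

(** * Hexahedral coordinates *)

Ltac reorder p := by apply: perm_trans p; apply/permP => P /=; ring.

Section HexahedralForms.
Variables (K : numFieldType) (n : nat -> K) (xi : nat -> 'cV[K]_3).

(** The equation of the projection from the node of the line
    [x_i + x_j = x_k + x_l = 0]: the combination of the two sums that vanishes
    at the node. *)
Definition side_form (i j k l : nat) : 'cV[K]_3 :=
  (n k + n l) *: (xi i + xi j) - (n i + n j) *: (xi k + xi l).

(** The combination of [xi x], [xi y], [xi z] that vanishes at the node and on
    the locus where the three forms are equal. *)
Definition salmon_form (x y z : nat) : 'cV[K]_3 :=
  (n y - n z) *: xi x + (n z - n x) *: xi y + (n x - n y) *: xi z.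

Definition disc (x y z : nat) : K := (n x - n y) * (n y - n z) * (n z - n x).

(** The plane is a complement of the node in the four-dimensional space
    [sum x_i = sum n_i^2 x_i = 0], and [xi i] is the restriction of [x_i] to
    it.  Another complement changes [xi i] to [xi i + n i *: m] for a fixed form
    [m], which affects neither [side_form] nor [salmon_form]. *)
Record hexahedral (Q : 'M[K]_3) (G : letter -> {vspace 'rV[K]_3}) : Prop := {
  hex_sum_n : \sum_(i <- SIX) n i = 0;
  hex_sum_n3 : \sum_(i <- SIX) n i ^+ 3 = 0;
  hex_sum_xi : \sum_(i <- SIX) xi i = 0;
  hex_sum_n2xi : \sum_(i <- SIX) n i ^+ 2 *: xi i = 0;
  hex_nD : forall i j, i \in SIX -> j \in SIX -> i != j -> n i + n j != 0;
  hex_point : forall l, is_point (G l);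
  hex_triangle : forall a b c, uniq [:: a; b; c] -> ~~ (G a <= G b + G c)%VS;
  hex_side : forall a b i j k l,
    contains (label a b) i j -> contains (label a b) k l -> i \notin [:: k; l] ->
    (G a + G b)%VS = line (side_form i j k l);
  hex_polar : exists2 c, c != 0 & forall x y z u v w,
    perm_eq [:: x; y; z; u; v; w] SIX ->
    ((salmon_form x y z)^T *m invmx Q *m salmon_form u v w) 0 0 =
    c * (disc x y z * disc u v w)
}.

End HexahedralForms.

Section Triangles.
Variables (K : fieldType) (G : letter -> {vspace 'rV[K]_3}).
Hypothesis Gpoint : forall l, is_point (G l).
Hypothesis Gtriangle : forall a b c, uniq [:: a; b; c] -> ~~ (G a <= G b + G c)%VS.

Lemma dim_side a b : a != b -> \dim (G a + G b)%VS = 2%N.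
Proof.
move=> ab; have [c [ca cb]] : exists c, c != a /\ c != b.
  by case: a b ab => -[] // _; (by exists A) || (by exists B) || (by exists C).
have /Gtriangle nab : uniq [:: a; b; c] by rewrite /= !inE negb_or ab eq_sym ca eq_sym cb.
have cap0 : (G a :&: G b)%VS = 0%VS.
  apply/eqP; rewrite -dimv_eq0; apply: contraNT nab => h.
  have /eqP <- : (G a :&: G b)%VS == G a.
    by rewrite eqEdim capvSl (Gpoint a) /= lt0n.
  exact: subv_trans (capvSr _ _) (addvSl _ _).
have := dimv_sum_cap (G a) (G b).
by rewrite cap0 dimv0 addn0 (Gpoint a) (Gpoint b).
Qed.

Lemma cap_sides a b c : uniq [:: a; b; c] ->
  ((G a + G b) :&: (G a + G c))%VS = G a.
Proof.
move=> u; have := u; rewrite /= !inE negb_or andbT => /andP [/andP [ab ac] bc].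
apply/esym/eqP; rewrite eqEdim subv_cap !addvSl (Gpoint a) /=.
rewrite leqNgt; apply/negP => h.
have /Gtriangle/negP : uniq [:: b; a; c] by rewrite /= !inE negb_or eq_sym ab bc ac.
apply.
have /eqP e : ((G a + G b) :&: (G a + G c))%VS == (G a + G b)%VS.
  by rewrite eqEdim capvSl dim_side.
by apply: subv_trans (addvSr (G a) _) _; rewrite -e capvSr.
Qed.

End Triangles.

Section PascalConfiguration.
Variables (K : numFieldType) (n : nat -> K) (xi : nat -> 'cV[K]_3).
Variables (Q : 'M[K]_3) (G : letter -> {vspace 'rV[K]_3}).
Hypothesis hQ : nonsingular_conic Q.
Hypothesis H : hexahedral n xi Q G.

Notation side := (side_form n xi).
Notation salmon := (salmon_form n xi).

Lemma sum_SIX (V : nmodType) (f : nat -> V) x y z u v w :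
  perm_eq [:: x; y; z; u; v; w] SIX ->
  \sum_(i <- SIX) f i = f x + f y + f z + f u + f v + f w.
Proof.
by move=> p; rewrite -(perm_big _ p) /= !big_cons big_nil addr0 !addrA.
Qed.

(** The coordinate [x_i] of the point [v + t n] on the line that projects
    [v] from the node. *)
Definition hexcoord (v : 'rV[K]_3) (t : K) (i : nat) : K := (v *m xi i) 0 0 + t * n i.

Lemma sum_hexcoord v t : \sum_(i <- SIX) hexcoord v t i = 0.
Proof.
rewrite big_split /= -mulr_sumr (hex_sum_n H) mulr0 addr0.
have := congr1 (fun a => (v *m a) 0 0) (hex_sum_xi H).
by rewrite /= mulmx_sumr summxE mulmx0 mxE.
Qed.

Lemma sum_n2_hexcoord v t : \sum_(i <- SIX) n i ^+ 2 * hexcoord v t i = 0.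
Proof.
have := congr1 (fun a => (v *m a) 0 0) (hex_sum_n2xi H).
rewrite /= mulmx_sumr summxE mulmx0 [RHS]mxE => h.
transitivity (\sum_(i <- SIX) (v *m (n i ^+ 2 *: xi i)) 0 0
              + t * \sum_(i <- SIX) n i ^+ 3).
  rewrite mulr_sumr -big_split; apply: eq_bigr => i _ /=.
  rewrite -scalemxAr [X in _ = X + _]mxE /hexcoord; ring.
by rewrite h (hex_sum_n3 H) mulr0 addr0.
Qed.

Lemma mem_side v i j k l : (v \in line (side i j k l)) =
  ((n k + n l) * ((v *m xi i) 0 0 + (v *m xi j) 0 0) ==
   (n i + n j) * ((v *m xi k) 0 0 + (v *m xi l) 0 0)).
Proof.
rewrite mem_line -[RHS]subr_eq0 /side_form mulmxBr -!scalemxAr !mulmxDr.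
set a := v *m xi i; set b := v *m xi j; set c := v *m xi k; set d := v *m xi l.
have e : ((n k + n l) *: (a + b) - (n i + n j) *: (c + d)) 0 0 =
  (n k + n l) * (a 0 0 + b 0 0) - (n i + n j) * (c 0 0 + d 0 0) by rewrite !mxE.
rewrite -e; apply/eqP/eqP => [->|h]; first by rewrite mxE.
by apply/matrixP => r s; rewrite !ord1 h mxE.
Qed.

(** As [n i + n j != 0], exactly one point of the projecting line has
    [x_i + x_j = 0]. *)
Lemma mem_sideP v i j k l : i \in SIX -> j \in SIX -> k \in SIX -> l \in SIX ->
  i != j -> k != l ->
  reflect (exists t, hexcoord v t i + hexcoord v t j = 0 /\
                     hexcoord v t k + hexcoord v t l = 0)
    (v \in line (side i j k l)).
Proof.
move=> iS jS kS lS ij kl; rewrite mem_side /hexcoord.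
have nij := hex_nD H iS jS ij; have nkl := hex_nD H kS lS kl.
set a := (v *m xi i) 0 0; set b := (v *m xi j) 0 0.
set c := (v *m xi k) 0 0; set d := (v *m xi l) 0 0.
apply: (iffP eqP) => [e|[t [e1 e2]]].
  exists (- (a + b) / (n i + n j)); split; first by field.
  apply: (mulfI nij); rewrite mulr0.
  transitivity ((n i + n j) * (c + d) - (n k + n l) * (a + b)); first by field.
  by rewrite e subrr.
have -> : a + b = - t * (n i + n j) by apply/eqP; rewrite -subr_eq0 -e1; apply/eqP; ring.
have -> : c + d = - t * (n k + n l) by apply/eqP; rewrite -subr_eq0 -e2; apply/eqP; ring.
ring.
Qed.

Lemma hexcoord_inj_t v t t' i j : i \in SIX -> j \in SIX -> i != j ->
  hexcoord v t i + hexcoord v t j = 0 -> hexcoord v t' i + hexcoord v t' j = 0 -> t = t'.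
Proof.
move=> iS jS ij e e'; apply: (mulIf (hex_nD H iS jS ij)).
apply/eqP; rewrite -subr_eq0.
have -> : t * (n i + n j) - t' * (n i + n j) =
  (hexcoord v t i + hexcoord v t j) - (hexcoord v t' i + hexcoord v t' j).
  by rewrite /hexcoord; ring.
by rewrite e e' subrr.
Qed.

Lemma meet_on_pascalP x y z a b c d : x \in SIX -> y \in SIX -> z \in SIX ->
  meet_on_pascal x y z a b c d ->
  ((G a + G b) :&: (G c + G d) <= line (side x y x z))%VS /\
  (line (side x y x z) :&: (G a + G b) <= G c + G d)%VS.
Proof.
move=> xS yS zS /hasP [q qS /hasP [r rS /and4P [u abqr cdqr h]]].
move: u; rewrite /= !inE !negb_or -!andbA.
move=> /and5P [xy xz xq xr /and5P [yz yq yr zq /and3P [zr qr _]]].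
have nxy : x \notin [:: q; r] by rewrite !inE negb_or xq.
wlog {h} /andP [abxy cdxz] : y z yS zS xy xz yz yq yr zq zr /
    contains (label a b) x y && contains (label c d) x z.
  move=> W; case/orP: h => h; first exact: (W y z).
  have -> : line (side x y x z) = line (side x z x y).
    by apply/vspaceP => v; rewrite !mem_side eq_sym.
  by apply: (W z y) => //; rewrite eq_sym.
rewrite (hex_side H abxy abqr nxy) (hex_side H cdxz cdqr nxy).
split; apply/subvP => v; rewrite memv_cap => /andP [].
  move=> /(mem_sideP _ xS yS qS rS xy qr) [t [e1 e2]].
  move=> /(mem_sideP _ xS zS qS rS xz qr) [t' [e1' e2']].
  apply/(mem_sideP _ xS yS xS zS xy xz); exists t; split=> //.
  by rewrite (hexcoord_inj_t qS rS qr e2 e2').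
move=> /(mem_sideP _ xS yS xS zS xy xz) [t [e1 e2]].
move=> /(mem_sideP _ xS yS qS rS xy qr) [t' [e1' e2']].
apply/(mem_sideP _ xS zS qS rS xz qr); exists t; split=> //.
by rewrite (hexcoord_inj_t xS yS xy e1 e1').
Qed.

Lemma mem_point l v : v \in G l -> v != 0 -> G l = <[v]>%VS.
Proof.
move=> vl v0; apply/esym/eqP.
by rewrite eqEdim -memvE vl (hex_point H l) dim_vline v0.
Qed.

(** Pascal's theorem: the meets of opposite sides satisfy the linear equation of
    the Pascal.  Two of the meets differ, for a common one would be the
    vertex [a2] of two adjacent sides and would lie on the side [a4 a5]. *)
Lemma pascal_kE x y z : x \in SIX -> y \in SIX -> z \in SIX -> uniq [:: x; y; z] ->
  pascal_k G x y z = line (side x y x z).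
Proof.
move=> xS yS zS u; have := hexagon_pascal xS yS zS u; rewrite /pascal_k.
case: (hexagon x y z) => [|a1 [|a2 [|a3 [|a4 [|a5 [|a6 [|? ?]]]]]]] //=.
move=> /and4P [ua h1 h2 h3].
have [p1 q1] := meet_on_pascalP xS yS zS h1.
have [p2 _] := meet_on_pascalP xS yS zS h2.
have [p3 _] := meet_on_pascalP xS yS zS h3.
move: ua; rewrite !inE !negb_or -!andbA => ua.
case/and5P: ua => a12 a13 a14 a15 /and5P [a16 a23 a24 a25 /and5P [a26 a34 a35 a36]].
case/and4P=> a45 a46 a56 _.
have dimS := dim_side (hex_point H) (hex_triangle H).
have tri := hex_triangle H.
apply: line_eq.
- apply/eqP => k0.
  have /tri/negP[] : uniq [:: a1; a4; a5] by rewrite /= !inE negb_or a14 a15 a45.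
  apply: subv_trans (addvSl _ (G a2)) _; rewrite -(capfv (G a1 + G a2)%VS).
  apply: subv_trans q1; apply: capvS => //; apply/subvP => v _.
  by rewrite mem_line k0 mulmx0.
- by rewrite !subv_add p1 p2 p3.
apply: leq_trans (dimvS (addvSl _ _)).
set P := (_ :&: _)%VS; set P' := (_ :&: _)%VS.
have PP' : (P :&: P')%VS = 0%VS.
  apply/eqP; rewrite -subv0; apply/subvP => v.
  rewrite !memv_cap => /andP [/andP [v12 v45] /andP [v23 v56]].
  rewrite memv0; apply/negPn/negP => v0.
  have va : v \in G a2.
    rewrite -(@cap_sides _ _ (hex_point H) tri a2 a1 a3) ?memv_cap 1?addvC ?v12 //.
    by rewrite /= !inE negb_or eq_sym a12 a23 a13.
  have /tri/negP[] : uniq [:: a2; a4; a5] by rewrite /= !inE negb_or a24 a25 a45.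
  by rewrite (mem_point va v0) -memvE.
have := dimv_sum_cap P P'; rewrite PP' dimv0 addn0 => ->.
by apply: (@leq_add 1 1); apply: dim_cap_gt0; rewrite dimS // eq_sym.
Qed.

(** * Kirkman points and Cayley-Salmon lines *)

(** The first two Pascals give the same [t], and the third equation follows. *)
Lemma mem_kirkman v w x y z : {subset [:: w; x; y; z] <= SIX} -> uniq [:: w; x; y; z] ->
  reflect (exists t, [/\ hexcoord v t w + hexcoord v t x = 0,
                         hexcoord v t w + hexcoord v t y = 0
                       & hexcoord v t w + hexcoord v t z = 0])
    (v \in kirkman G w x y z).
Proof.
move=> S; have [wS xS yS zS] : [/\ w \in SIX, x \in SIX, y \in SIX & z \in SIX].
  by split; apply: S; rewrite !inE eqxx ?orbT.
rewrite /= !inE !negb_or -!andbA => /and5P [wx wy wz xy /and3P [xz yz _]].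
rewrite /kirkman !pascal_kE //= ?inE ?negb_or ?wx ?wy ?wz ?xy ?xz ?yz // !memv_cap -andbA.
apply: (iffP and3P) => [[]|[t [ex ey ez]]].
  move=> /(mem_sideP _ wS xS wS yS wx wy) [t [e1 e2]].
  move=> /(mem_sideP _ wS xS wS zS wx wz) [t' [e1' e2']] _.
  by exists t; split=> //; rewrite (hexcoord_inj_t wS xS wx e1 e1').
by split; apply/mem_sideP => //; exists t.
Qed.

Lemma perm6_data x y z u v w : perm_eq [:: x; y; z; u; v; w] SIX ->
  uniq [:: x; y; z; u; v; w] /\ {subset [:: x; y; z; u; v; w] <= SIX}.
Proof. by move=> p; split; [rewrite (perm_uniq p) | move=> i; rewrite (perm_mem p)]. Qed.

(** A vector whose coordinates all vanish would lie on every chord. *)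
Lemma hexcoord_inj v t : (forall i, i \in SIX -> hexcoord v t i = 0) -> v = 0.
Proof.
move=> X0.
have inG a b : a != b -> v \in (G a + G b)%VS.
  move=> ab; have [i [j [k [l [Sijkl c1 c2 u]]]]] : exists i j k l,
     [/\ {subset [:: i; j; k; l] <= SIX}, contains (label a b) i j,
         contains (label a b) k l & uniq [:: i; j; k; l]].
    have : let p := nth (0, 0)%N (label a b) 0 in let q := nth (0, 0)%N (label a b) 1 in
      [&& all (mem SIX) [:: p.1; p.2; q.1; q.2], contains (label a b) p.1 p.2,
          contains (label a b) q.1 q.2 & uniq [:: p.1; p.2; q.1; q.2]].
      by case: a b ab => -[].
    cbv zeta; case/and4P=> [/allP S c1 c2 u].
    by exists (nth (0, 0)%N (label a b) 0).1, (nth (0, 0)%N (label a b) 0).2,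
              (nth (0, 0)%N (label a b) 1).1, (nth (0, 0)%N (label a b) 1).2.
  have [iS jS kS lS] : [/\ i \in SIX, j \in SIX, k \in SIX & l \in SIX].
    by split; apply: Sijkl; rewrite !inE eqxx ?orbT.
  move: u; rewrite /= !inE !negb_or -!andbA => /and5P [ij ik il _ /and3P [_ kl _]].
  rewrite (hex_side H c1 c2) ?inE ?negb_or ?ik //.
  by apply/mem_sideP => //; exists t; rewrite !X0 // addr0.
apply/eqP/negPn/negP => v0.
have vA : v \in G A.
  rewrite -(@cap_sides _ _ (hex_point H) (hex_triangle H) A B C) //.
  by rewrite memv_cap !inG.
have /(hex_triangle H)/negP[] : uniq [:: A; B; C] by [].
by rewrite (mem_point vA v0) -memvE inG.
Qed.

Lemma mem_salmon v x y z : (v \in line (salmon x y z)) =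
  ((n y - n z) * (v *m xi x) 0 0 + (n z - n x) * (v *m xi y) 0 0
   + (n x - n y) * (v *m xi z) 0 0 == 0).
Proof.
rewrite mem_line /salmon_form !mulmxDr -!scalemxAr.
set a := v *m xi x; set b := v *m xi y; set c := v *m xi z.
have e : ((n y - n z) *: a + (n z - n x) *: b + (n x - n y) *: c) 0 0 =
  (n y - n z) * a 0 0 + (n z - n x) * b 0 0 + (n x - n y) * c 0 0 by rewrite !mxE.
rewrite -e; apply/eqP/eqP => [->|h]; first by rewrite mxE.
by apply/matrixP => r s; rewrite !ord1 h mxE.
Qed.

Lemma kirkman_on_salmon w x y z :
  {subset [:: w; x; y; z] <= SIX} -> uniq [:: w; x; y; z] ->
  (kirkman G w x y z <= line (salmon x y z))%VS.
Proof.
move=> S u; apply/subvP => v /(mem_kirkman v S u) [t [ex ey ez]].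
rewrite mem_salmon; apply/eqP.
transitivity ((n y - n z) * (hexcoord v t w + hexcoord v t x)
  + (n z - n x) * (hexcoord v t w + hexcoord v t y)
  + (n x - n y) * (hexcoord v t w + hexcoord v t z)); first by rewrite /hexcoord; ring.
by rewrite ex ey ez !mulr0 !addr0.
Qed.

Lemma n_eq_of_sqr i j : i \in SIX -> j \in SIX -> i != j ->
  n i ^+ 2 = n j ^+ 2 -> n i = n j.
Proof.
move=> iS jS ij /eqP; rewrite -subr_eq0 subr_sqr mulf_eq0.
by rewrite (negPf (hex_nD H iS jS ij)) orbF subr_eq0 => /eqP.
Qed.

Ltac in_six p := by rewrite -(perm_mem p) !inE eqxx ?orbT.
Ltac distinct p :=
  have := perm_uniq p; rewrite /= !inE !negb_or -?andbA => /idP;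
  do ![case/andP=> ?]; by rewrite // eq_sym.

(** The relations [sum n_i = sum n_i^3 = 0] say that the triples
    [n_x, n_y, n_z] and [- n_u, - n_v, - n_w] have equal first and third power
    sums.  If the second ones agreed too, the triples would be equal up to order
    by Newton's identities, and one of the sums [n_x + n_u], [n_x + n_v],
    [n_x + n_w] would vanish. *)
Lemma sum_sqr_neq x y z u v w : perm_eq [:: x; y; z; u; v; w] SIX ->
  n x ^+ 2 + n y ^+ 2 + n z ^+ 2 != n u ^+ 2 + n v ^+ 2 + n w ^+ 2.
Proof.
move=> p; apply/eqP => e2.
have e1 := hex_sum_n H; rewrite (sum_SIX _ p) in e1.
have e3 := hex_sum_n3 H; rewrite (sum_SIX _ p) in e3.
have nxu : n x + n u != 0 by apply: (hex_nD H); [in_six p|in_six p|distinct p].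
have nxv : n x + n v != 0 by apply: (hex_nD H); [in_six p|in_six p|distinct p].
have nxw : n x + n w != 0 by apply: (hex_nD H); [in_six p|in_six p|distinct p].
suff : 6%:R * ((n x + n u) * (n x + n v) * (n x + n w)) = 0.
  by apply/eqP; rewrite !mulf_neq0 ?pnatr_eq0.
(* The product is the cubic with roots - n u, - n v, - n w evaluated at n x;
   subtracting the cubic with roots n x, n y, n z leaves multiples of d2, d3. *)
pose s1 := n x + n y + n z.
have ew : n w = - (s1 + n u + n v).
  by apply/eqP; rewrite -subr_eq0 -e1; apply/eqP; rewrite /s1; ring.
pose d2 := n x ^+ 2 + n y ^+ 2 + n z ^+ 2 - (n u ^+ 2 + n v ^+ 2 + n w ^+ 2).
pose d3 := n x ^+ 3 + n y ^+ 3 + n z ^+ 3 + n u ^+ 3 + n v ^+ 3 + n w ^+ 3.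
transitivity (2%:R * d3 + 3%:R * (n x - s1) * d2); first by rewrite /d3 /d2 ew /s1; ring.
by rewrite /d2 /d3 e2 e3 subrr !mulr0 addr0.
Qed.

Lemma hexcoord_opp a s i j :
  hexcoord a s i + hexcoord a s j = 0 -> hexcoord a s j = - hexcoord a s i.
Proof. by move=> /eqP; rewrite addrC addr_eq0 => /eqP. Qed.

(** Only [x_q] and [x_r] survive; their sum and the sum weighted by [n_i^2]
    vanish, and [n_q^2 != n_r^2]. *)
Lemma hexcoord_inj4 w x y z q r v t : perm_eq [:: w; x; y; z; q; r] SIX -> n q != n r ->
  hexcoord v t w = 0 -> hexcoord v t x = 0 -> hexcoord v t y = 0 ->
  hexcoord v t z = 0 -> v = 0.
Proof.
move=> p nqr ew ex ey ez.
have qS : q \in SIX by in_six p.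
have rS : r \in SIX by in_six p.
have rq : r != q by distinct p.
have := sum_hexcoord v t; have := sum_n2_hexcoord v t; rewrite !(sum_SIX _ p).
rewrite ew ex ey ez !mulr0 !add0r => e2 /eqP; rewrite addr_eq0 => /eqP e1.
have er : hexcoord v t r = 0.
  apply/eqP; move: e2; rewrite e1 => /eqP.
  have -> : n q ^+ 2 * - hexcoord v t r + n r ^+ 2 * hexcoord v t r =
    (n r ^+ 2 - n q ^+ 2) * hexcoord v t r by ring.
  rewrite mulf_eq0 subr_eq0 => /orP [/eqP h|//].
  by rewrite (n_eq_of_sqr rS qS rq h) eqxx in nqr.
apply: (@hexcoord_inj v t) => i; rewrite -(perm_mem p) !inE.
by case/or4P=> [/eqP ->|/eqP ->|/eqP ->|/or3P [] /eqP ->] //; rewrite e1 er oppr0.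
Qed.

Lemma perm6_head4 w x y z q r : perm_eq [:: w; x; y; z; q; r] SIX ->
  {subset [:: w; x; y; z] <= SIX} /\ uniq [:: w; x; y; z].
Proof.
move=> p; have [un S] := perm6_data p; split.
  by move=> i i4; apply: S; rewrite (mem_cat i [:: w; x; y; z] [:: q; r]) i4.
by move: un; rewrite (cat_uniq [:: w; x; y; z] [:: q; r]) => /and3P [].
Qed.

(** By [hexcoord_inj4] a vector of the Kirkman space is determined by its
    coordinate [x_w]; two Pascals always meet, so that the space is not zero. *)
Lemma dim_kirkman w x y z q r : perm_eq [:: w; x; y; z; q; r] SIX -> n q != n r ->
  \dim (kirkman G w x y z) = 1%N.
Proof.
move=> p nqr; have [S u] := perm6_head4 p.
have wS : w \in SIX by in_six p.
have xS : x \in SIX by in_six p.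
have yS : y \in SIX by in_six p.
have zS : z \in SIX by in_six p.
have wx : w != x by distinct p.
have wy : w != y by distinct p.
have wz : w != z by distinct p.
have [v v0] := meet_lines_neq0 (side w x w y) (side w x w z).
rewrite -!mem_line => /andP [].
move=> /(mem_sideP _ wS xS wS yS wx wy) [t [ex ey]].
move=> /(mem_sideP _ wS xS wS zS wx wz) [t' [ex' ez]].
have {ex'} tt := hexcoord_inj_t wS xS wx ex ex'; rewrite -{t'}tt in ez.
suff -> : kirkman G w x y z = <[v]>%VS by rewrite dim_vline v0.
have l0 : hexcoord v t w != 0.
  apply: contraNneq v0 => l0; apply/eqP; apply: (hexcoord_inj4 p nqr l0).
  - by rewrite (hexcoord_opp ex) l0 oppr0.
  - by rewrite (hexcoord_opp ey) l0 oppr0.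
  - by rewrite (hexcoord_opp ez) l0 oppr0.
apply/vspaceP => a; apply/(mem_kirkman a S u)/vlineP => [[s [hx hy hz]]|[c ->]].
  exists (hexcoord a s w / hexcoord v t w); apply/eqP; rewrite -subr_eq0; apply/eqP.
  set c := _ / _.
  have lin i : hexcoord (a - c *: v) (s - c * t) i = hexcoord a s i - c * hexcoord v t i.
    by rewrite /hexcoord mulmxBl -scalemxAl !mxE; ring.
  have lw : hexcoord (a - c *: v) (s - c * t) w = 0 by rewrite lin divfK // subrr.
  apply: (hexcoord_inj4 p nqr lw); rewrite lin.
  - by rewrite (hexcoord_opp hx) (hexcoord_opp ex) mulrN divfK // subrr.
  - by rewrite (hexcoord_opp hy) (hexcoord_opp ey) mulrN divfK // subrr.
  - by rewrite (hexcoord_opp hz) (hexcoord_opp ez) mulrN divfK // subrr.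
have lin i : hexcoord (c *: v) (c * t) i = c * hexcoord v t i.
  by rewrite /hexcoord -scalemxAl !mxE; ring.
by exists (c * t); rewrite !lin -!mulrDr ex ey ez mulr0.
Qed.

(** A common vector has coordinates [x_x = x_y = x_z = - s] and [s] at the other
    three indices; the equation [sum n_i^2 x_i = 0] then contradicts
    [sum_sqr_neq] unless [s = 0]. *)
Lemma kirkman_disjoint w w' x y z u : perm_eq [:: w; w'; x; y; z; u] SIX ->
  n x != n y -> (kirkman G w x y z :&: kirkman G w' x y z)%VS = 0%VS.
Proof.
move=> p nxy; apply/eqP; rewrite -subv0; apply/subvP => v; rewrite memv_cap memv0.
have p1 : perm_eq [:: w; x; y; z; w'; u] SIX by reorder p.
have p2 : perm_eq [:: w'; x; y; z; w; u] SIX by reorder p.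
have [S1 u1] := perm6_head4 p1; have [S2 u2] := perm6_head4 p2.
case/andP=> /(mem_kirkman v S1 u1) [t [ex ey ez]] /(mem_kirkman v S2 u2) [t' [fx fy fz]].
have tt : t' = t.
  apply: (mulIf (_ : n x - n y != 0)); first by rewrite subr_eq0.
  apply/eqP; rewrite -subr_eq0; apply/eqP.
  transitivity ((hexcoord v t' w' + hexcoord v t' x) - (hexcoord v t' w' + hexcoord v t' y)
     - ((hexcoord v t w + hexcoord v t x) - (hexcoord v t w + hexcoord v t y))).
    by rewrite /hexcoord; ring.
  by rewrite ex ey fx fy !subrr.
rewrite {t'}tt in fx fy fz.
have := hexcoord_opp ex; have := hexcoord_opp ey; have := hexcoord_opp ez.
have [s ls] : exists s, hexcoord v t w = s by exists (hexcoord v t w).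
rewrite ls => lz ly lx.
have lw' : hexcoord v t w' = s by apply/eqP; rewrite -subr_eq0 -lx fx.
have lu : hexcoord v t u = s.
  have := sum_hexcoord v t; rewrite (sum_SIX _ p) lw' lx ly lz ls => e.
  by apply/eqP; rewrite -subr_eq0 -e; apply/eqP; ring.
have s0 : s = 0.
  have := sum_n2_hexcoord v t; rewrite (sum_SIX _ p) lw' lx ly lz lu ls => e.
  have p3 : perm_eq [:: w; w'; u; x; y; z] SIX by reorder p.
  have := sum_sqr_neq p3; rewrite -subr_eq0 => d0.
  by apply: (mulIf d0); rewrite mul0r -e; ring.
apply/eqP; apply: (@hexcoord_inj v t) => i; rewrite -(perm_mem p) !inE.
case/or4P=> [/eqP ->|/eqP ->|/eqP ->|/or3P [] /eqP ->];
  by rewrite ?ls ?lw' ?lx ?ly ?lz ?lu s0 ?oppr0.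
Qed.

Lemma disc_neq0 x y z :
  (disc n x y z != 0) = [&& n x != n y, n y != n z & n z != n x].
Proof. by rewrite /disc !mulf_eq0 !subr_eq0 !negb_or andbA. Qed.

Lemma perm_notin x y z u v w : perm_eq [:: x; y; z; u; v; w] SIX ->
  u \in SIX /\ u \notin [:: x; y; z].
Proof.
by move=> p; split; [in_six p | rewrite !inE !negb_or; apply/and3P; split; distinct p].
Qed.

Lemma cayley_salmon_definedP x y z u v w : perm_eq [:: x; y; z; u; v; w] SIX ->
  disc n x y z != 0 -> disc n u v w != 0 -> cayley_salmon_defined G x y z.
Proof.
move=> p; rewrite !disc_neq0 => /and3P [nxy _ _] /and3P [nuv nvw nwu].
exists u, v.
have pu : perm_eq [:: u; x; y; z; v; w] SIX by reorder p.
have pv : perm_eq [:: v; x; y; z; w; u] SIX by reorder p.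
have p3 : perm_eq [:: u; v; x; y; z; w] SIX by reorder p.
have du := dim_kirkman pu nvw.
split; [exact: perm_notin p | | exact: du | exact: (dim_kirkman pv nwu) |].
  by apply: (@perm_notin _ _ _ _ w u); reorder p.
apply/eqP => e; have := kirkman_disjoint p3 nxy; rewrite -e capvv => k0.
by rewrite k0 dimv0 in du.
Qed.

Lemma notin3_head4 w x y z : w \in SIX -> w \notin [:: x; y; z] ->
  {subset [:: x; y; z] <= SIX} -> uniq [:: x; y; z] ->
  {subset [:: w; x; y; z] <= SIX} /\ uniq [:: w; x; y; z].
Proof.
move=> wS wn S u; split; last by rewrite cons_uniq wn.
by move=> i; rewrite inE => /orP [/eqP -> //|/S].
Qed.

Lemma cayley_salmonE x y z : {subset [:: x; y; z] <= SIX} -> uniq [:: x; y; z] ->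
  cayley_salmon_defined G x y z -> salmon x y z != 0 ->
  cayley_salmon G x y z = line (salmon x y z).
Proof.
move=> S u [v [w [[vS vn] [wS wn] dv dw vw]]] s0; apply: line_eq => //.
  rewrite /cayley_salmon big_seq_cond.
  apply: (big_ind (fun U => U <= line (salmon x y z))%VS); first exact: sub0v.
    by move=> U V hU hV; rewrite subv_add hU.
  move=> i /andP [iS /andP [ixyz _]].
  by have [S4 u4] := notin3_head4 iS ixyz S u; exact: kirkman_on_salmon.
have sub i : i \in SIX -> i \notin [:: x; y; z] -> kirkman_defined G i x y z ->
    (kirkman G i x y z <= cayley_salmon G x y z)%VS.
  move=> iS ixyz di; rewrite /cayley_salmon (big_rem i) //= ixyz.
  by rewrite di eqxx addvSl.
rewrite ltnNge; apply/negP => d1.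
have e i : i \in SIX -> i \notin [:: x; y; z] -> kirkman_defined G i x y z ->
    kirkman G i x y z = cayley_salmon G x y z.
  by move=> iS ixyz di; apply/eqP; rewrite eqEdim sub //= di.
by rewrite !e // eqxx in vw.
Qed.

(** When the three values agree, membership in the Kirkman space amounts to
    [xi x = xi y = xi z], a condition in which [w] does not appear. *)
Lemma cayley_salmon_undefined x y z : {subset [:: x; y; z] <= SIX} -> uniq [:: x; y; z] ->
  n x = n y -> n y = n z -> ~ cayley_salmon_defined G x y z.
Proof.
move=> S u nxy nyz [v [w [[vS vn] [wS wn] _ _ /eqP[]]]].
have xS : x \in SIX by apply: S; rewrite !inE eqxx.
suff k i a : i \in SIX -> i \notin [:: x; y; z] -> (a \in kirkman G i x y z) =
    ((a *m xi x) 0 0 == (a *m xi y) 0 0) && ((a *m xi y) 0 0 == (a *m xi z) 0 0).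
  by apply/vspaceP => a; rewrite !k.
move=> iS ixyz; have [S4 u4] := notin3_head4 iS ixyz S u.
have nix : n i + n x != 0.
  by apply: hex_nD H _ _ iS xS _; apply: contraNneq ixyz => ->; rewrite inE eqxx.
apply/(mem_kirkman a S4 u4)/andP => [[t [ex ey ez]]|[/eqP ea /eqP eb]].
  have lx := hexcoord_opp ex; have ly := hexcoord_opp ey; have lz := hexcoord_opp ez.
  by split; apply/eqP; apply: (addIr (t * n y)); [rewrite -{1}nxy|rewrite {2}nyz];
    rewrite -!/(hexcoord _ _ _) ?lx ?ly ?lz.
exists (- ((a *m xi i) 0 0 + (a *m xi x) 0 0) / (n i + n x)).
have ex : hexcoord a (- ((a *m xi i) 0 0 + (a *m xi x) 0 0) / (n i + n x)) i +
  hexcoord a (- ((a *m xi i) 0 0 + (a *m xi x) 0 0) / (n i + n x)) x = 0.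
  by rewrite /hexcoord; field.
by split; move: ex; rewrite /hexcoord -?nyz -?nxy -?eb -?ea.
Qed.

(** If the form vanished, every vector [a] would have a lift with
    [x_x = x_y = x_z].  Two more coordinates can be made to vanish by the choice
    of [a != 0]; doing this for [x, u] and for [x, v] shows that
    [n u = n v = n w], and doing it for [u, v] contradicts [sum_sqr_neq]. *)
Lemma salmon_neq0 x y z u v w : perm_eq [:: x; y; z; u; v; w] SIX ->
  n x != n y -> salmon x y z != 0.
Proof.
move=> p nxy; apply/eqP => s0; have dxy : n x - n y != 0 by rewrite subr_eq0.
have aux i j : exists2 a : 'rV[K]_3, a != 0 & exists t,
    [/\ hexcoord a t y = hexcoord a t x, hexcoord a t z = hexcoord a t x,
        hexcoord a t i = 0 & hexcoord a t j = 0].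
  (* (n x - n y) x_k for the lift of a with x_x = x_y *)
  pose eta k := (n x - n y) *: xi k - n k *: (xi x - xi y).
  have [a a0 /andP [/eqP ai /eqP aj]] := meet_lines_neq0 (eta i) (eta j).
  exists a => //; pose t := - ((a *m xi x) 0 0 - (a *m xi y) 0 0) / (n x - n y).
  have eta0 k : a *m eta k = 0 -> hexcoord a t k = 0.
    rewrite /eta mulmxBr -!scalemxAr mulmxBr.
    set b := a *m xi x; set c := a *m xi y; set d := a *m xi k.
    move=> /(congr1 (fun M : 'M[K]_1 => M 0 0)).
    have -> : ((n x - n y) *: d - n k *: (b - c)) 0 0 =
      (n x - n y) * d 0 0 - n k * (b 0 0 - c 0 0) by rewrite !mxE.
    rewrite [RHS]mxE => e; apply: (mulfI dxy); rewrite mulr0 -e /hexcoord /t -/b -/c -/d.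
    by field.
  have exy : hexcoord a t y = hexcoord a t x by rewrite /hexcoord /t; field.
  exists t; split; [exact: exy | | exact: eta0 | exact: eta0].
  have : a \in line (salmon x y z) by rewrite mem_line s0 mulmx0.
  rewrite mem_salmon => /eqP e; apply: (mulfI dxy); apply/eqP; rewrite -subr_eq0 -e.
  apply/eqP; transitivity ((n y - n z) * hexcoord a t x + (n z - n x) * hexcoord a t y
    + (n x - n y) * hexcoord a t z); first by rewrite exy; ring.
  by rewrite /hexcoord; ring.
have nvw : n v = n w.
  have [a a0 [t [ly lz lx lu]]] := aux x u.
  apply/eqP/negPn/negP => nvw; move/eqP: a0; apply.
  by apply: (hexcoord_inj4 p nvw lx _ _ lu); rewrite ?ly ?lz.
have nuw : n u = n w.
  have [a a0 [t [ly lz lx lv]]] := aux x v.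
  apply/eqP/negPn/negP => nuw; move/eqP: a0; apply.
  have p' : perm_eq [:: x; y; z; v; u; w] SIX by reorder p.
  by apply: (hexcoord_inj4 p' nuw lx _ _ lv); rewrite ?ly ?lz.
have [a a0 [t [ly lz lu lv]]] := aux u v.
have lw : hexcoord a t w = - (3%:R * hexcoord a t x).
  have := sum_hexcoord a t; rewrite (sum_SIX _ p) lu lv ly lz => e.
  by apply/eqP; rewrite -subr_eq0 -e; apply/eqP; ring.
have lx : hexcoord a t x = 0.
  have := sum_n2_hexcoord a t; rewrite (sum_SIX _ p) lu lv ly lz lw => e.
  have := sum_sqr_neq p; rewrite nuw nvw -subr_eq0 => d0.
  by apply: (mulIf d0); rewrite mul0r -e; ring.
move/eqP: a0; apply; apply: (@hexcoord_inj a t) => i; rewrite -(perm_mem p) !inE.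
by case/or4P=> [/eqP ->|/eqP ->|/eqP ->|/or3P [] /eqP ->];
  rewrite ?lw ?ly ?lz ?lx ?mulr0 ?oppr0.
Qed.

Lemma cayley_salmon_line x y z u v w : perm_eq [:: x; y; z; u; v; w] SIX ->
  cayley_salmon_defined G x y z ->
  salmon x y z != 0 /\ cayley_salmon G x y z = line (salmon x y z).
Proof.
move=> p d; have [un S] := perm6_data p.
have S3 : {subset [:: x; y; z] <= SIX}.
  by move=> i i3; apply: S; rewrite (mem_cat i [:: x; y; z] [:: u; v; w]) i3.
have u3 : uniq [:: x; y; z].
  by move: un; rewrite (cat_uniq [:: x; y; z] [:: u; v; w]) => /and3P [].
suff s0 : salmon x y z != 0 by split=> //; exact: cayley_salmonE.
have [nxy|nxy] := eqVneq (n x) (n y); last exact: salmon_neq0 p nxy.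
have [nyz|nyz] := eqVneq (n y) (n z); first by case: (cayley_salmon_undefined S3 u3 nxy nyz).
have -> : salmon x y z = salmon y z x by rewrite /salmon_form -addrA addrC.
by apply: (@salmon_neq0 y z x u v w) => //; reorder p.
Qed.

(** * Conjugacy and coincidences among the invariants *)

(** Blocks of distinct values have defined lines, and [hex_polar] gives the
    pole condition between them a nonzero value. *)
Lemma CSC_disc x y z u v w : CSC Q G -> perm_eq [:: x; y; z; u; v; w] SIX ->
  disc n x y z * disc n u v w = 0.
Proof.
move=> csc p; apply/eqP/negPn/negP; rewrite mulf_eq0 negb_or => /andP [d1 d2].
have p' : perm_eq [:: u; v; w; x; y; z] SIX by reorder p.
have def1 := cayley_salmon_definedP p d1 d2; have def2 := cayley_salmon_definedP p' d2 d1.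
have [s1 e1] := cayley_salmon_line p def1; have [s2 e2] := cayley_salmon_line p' def2.
have := csc _ _ _ _ _ _ p def1 def2; rewrite e1 e2 => /(conjugate_lines _ hQ s1).
have [c c0 ->] := hex_polar H; last exact: p.
by apply/eqP; exact: mulf_neq0 c0 (mulf_neq0 d1 d2).
Qed.

Lemma disc_eq0 i j x y z : i != j -> i \in [:: x; y; z] -> j \in [:: x; y; z] ->
  n i = n j -> disc n x y z = 0.
Proof.
rewrite !inE => ij /or3P [] /eqP ei /or3P [] /eqP ej nij;
  move: nij ij; rewrite ei ej /disc => nij; rewrite ?eqxx ?nij // => _; ring.
Qed.

Definition three_equal := exists i j k,
  [/\ uniq [:: i; j; k], {subset [:: i; j; k] <= SIX}, n i = n j & n j = n k].

Lemma three_equal_CSC : three_equal -> CSC Q G.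
Proof.
move=> [i [j [k [u3 S nij njk]]]] x y z u v w p def1 def2.
have p' : perm_eq [:: u; v; w; x; y; z] SIX by reorder p.
have [s1 ->] := cayley_salmon_line p def1; have [_ ->] := cayley_salmon_line p' def2.
apply/(conjugate_lines _ hQ s1); have [c _ ->] := hex_polar H; last exact: p.
suff : (disc n x y z == 0) || (disc n u v w == 0).
  by rewrite -mulf_eq0 => /eqP ->; rewrite mulr0.
have block a b : a != b -> n a = n b ->
    (a \in [:: x; y; z]) && (b \in [:: x; y; z])
      || (a \in [:: u; v; w]) && (b \in [:: u; v; w]) ->
    (disc n x y z == 0) || (disc n u v w == 0).
  move=> ab nab /orP [] /andP [ha hb]; apply/orP; [left|right]; apply/eqP;
    exact: disc_eq0 ab ha hb nab.
have cover a : a \in [:: i; j; k] -> (a \in [:: x; y; z]) || (a \in [:: u; v; w]).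
  by move=> /S; rewrite -(perm_mem p) -mem_cat.
move: u3; rewrite /= !inE negb_or andbT => /andP [/andP [ij ik] jk].
have ci : i \in [:: i; j; k] by rewrite inE eqxx.
have cj : j \in [:: i; j; k] by rewrite !inE eqxx orbT.
have ck : k \in [:: i; j; k] by rewrite !inE eqxx !orbT.
have nik : n i = n k by rewrite nij.
move: (cover i ci) (cover j cj) (cover k ck) (block i j ij nij) (block j k jk njk)
  (block i k ik nik).
move: (i \in [:: x; y; z]) (j \in [:: x; y; z]) (k \in [:: x; y; z]).
move: (i \in [:: u; v; w]) (j \in [:: u; v; w]) (k \in [:: u; v; w]).
by do 6![case] => //= *; auto.
Qed.

(** The blocks are formed by the terms of odd and of even rank in the sorted
    list of values, so that a coincidence in one block squeezes a third equal
    value between.  The order of the field need not be total, so that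
    values are sorted by the rank of their first occurrence. *)
Lemma CSC_three_equal : CSC Q G -> three_equal.
Proof.
move=> csc; pose f i := index (n i) [seq n j | j <- SIX].
have nf i j : i \in SIX -> j \in SIX -> f i = f j -> n i = n j.
  move=> iS jS e; have nS a : a \in SIX -> n a \in [seq n j | j <- SIX].
    by move=> aS; apply: map_f.
  by rewrite -(nth_index 0 (nS i iS)) -/(f i) e nth_index ?nS.
pose le i j := (f i <= f j)%N.
have ps : perm_eq (sort le SIX) SIX by rewrite perm_sort.
have ss : sorted le (sort le SIX) by apply: sort_sorted => i j; exact: leq_total.
move: ps ss; have : size (sort le SIX) = 6%N by rewrite size_sort.
case: (sort le SIX) => [|x [|u [|y [|v [|z [|w [|? ?]]]]]]] //= _ p.
rewrite /le => /and5P [fxu fuy fyv fvz /andP [fzw _]].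
have pS a : a \in [:: x; u; y; v; z; w] -> a \in SIX by rewrite (perm_mem p).
have triple a b c : uniq [:: a; b; c] -> {subset [:: a; b; c] <= [:: x; u; y; v; z; w]} ->
    (f a <= f b)%N -> (f b <= f c)%N -> n a = n c -> three_equal.
  move=> uabc Sabc fab fbc nac.
  have aS : a \in SIX by apply: pS; apply: Sabc; rewrite inE eqxx.
  have bS : b \in SIX by apply: pS; apply: Sabc; rewrite !inE eqxx orbT.
  have fac : f a = f c by rewrite /f nac.
  have fabe : f a = f b by apply/eqP; rewrite eqn_leq fab /= fac.
  have nab := nf a b aS bS fabe.
  by exists a, b, c; split=> // [d /Sabc/pS|]; rewrite // -nab.
have p' : perm_eq [:: x; y; z; u; v; w] SIX by reorder p.
have fxy := leq_trans fxu fuy; have fuv := leq_trans fuy fyv.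
have fyz := leq_trans fyv fvz; have fvw := leq_trans fvz fzw.
have Sb a b c : a \in [:: x; u; y; v; z; w] -> b \in [:: x; u; y; v; z; w] ->
    c \in [:: x; u; y; v; z; w] -> {subset [:: a; b; c] <= [:: x; u; y; v; z; w]}.
  by move=> ha hb hc; apply/allP; rewrite /= ha hb hc.
have := perm_uniq p; rewrite /= !inE !negb_or -?andbA => /idP.
do ![case/andP=> ?]; move=> _.
have /eqP := CSC_disc csc p'; rewrite mulf_eq0 /disc !mulf_eq0 !subr_eq0 -!orbA.
case/or4P=> [/eqP e|/eqP e|/eqP e|/or3P [] /eqP e].
- apply: (triple x u y) => //; last by apply: Sb; rewrite !inE eqxx ?orbT.
  by rewrite /= !inE !negb_or; apply/and3P; split=> //; apply/andP; split.
- apply: (triple y v z) => //; last by apply: Sb; rewrite !inE eqxx ?orbT.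
  by rewrite /= !inE !negb_or; apply/and3P; split=> //; apply/andP; split.
- apply: (triple x y z) => //; last by apply: Sb; rewrite !inE eqxx ?orbT.
  by rewrite /= !inE !negb_or; apply/and3P; split=> //; first last; apply/andP; split.
- apply: (triple u y v) => //; last by apply: Sb; rewrite !inE eqxx ?orbT.
  by rewrite /= !inE !negb_or; apply/and3P; split=> //; apply/andP; split.
- apply: (triple v z w) => //; last by apply: Sb; rewrite !inE eqxx ?orbT.
  by rewrite /= !inE !negb_or; apply/and3P; split=> //; apply/andP; split.
- apply: (triple u v w) => //; last by apply: Sb; rewrite !inE eqxx ?orbT.
  by rewrite /= !inE !negb_or; apply/and3P; split=> //; apply/andP; split.
Qed.

End PascalConfiguration.

(** * The projective line and the conic *)

Section Bracket.
Variable K : fieldType.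
Implicit Types u v w : 'rV[K]_2.

Definition bracket u v : K := u 0 0 * v 0 1 - u 0 1 * v 0 0.

Definition veronese v : 'rV[K]_3 :=
  \row_(j < 3) [:: v 0 0 ^+ 2; v 0 0 * v 0 1; v 0 1 ^+ 2]`_j.

(** The equation of the line that joins the Veronese images of [u] and [v]. *)
Definition chord u v : 'cV[K]_3 :=
  \col_(j < 3) [:: u 0 1 * v 0 1; - (u 0 0 * v 0 1 + u 0 1 * v 0 0); u 0 0 * v 0 0]`_j.

(** The classical condition for three pairs of points of the projective line to
    be exchanged by one involution. *)
Definition involution a a' b b' c c' : K :=
  bracket a b' * bracket b c' * bracket c a' + bracket a' b * bracket b' c * bracket c' a.

(** Up to sign the involution condition is the determinant of the three chords;
    the center of the involution is the point common to them. *)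
Lemma involutionP a a' b b' c c' :
  involution a a' b b' c c' = 0 <->
  exists2 w : 'rV[K]_3, w != 0 &
    forall p, p \in [:: (a, a'); (b, b'); (c, c')] -> w *m chord p.1 p.2 = 0.
Proof.
pose p := [:: (a, a'); (b, b'); (c, c')].
pose M := \matrix_(i < 3, j < 3)
  (let q := nth (a, a') p j in chord q.1 q.2) i 0.
have dM : \det M = - involution a a' b b' c c'.
  by rewrite det3 !mxE /involution /bracket /=; ring.
have wM (w : 'rV[K]_3) (j : 'I_3) :
    (w *m M) 0 j = (let q := nth (a, a') p j in w *m chord q.1 q.2) 0 0.
  by rewrite !mxE; apply: eq_bigr => i _; rewrite mxE.
have -> : involution a a' b b' c c' = 0 <-> \det M == 0.
  by rewrite dM oppr_eq0; split=> /eqP.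
split=> [/det0P [w w0 e]|[w w0 h]]; last apply/det0P.
  exists w => // q /(nthP (a, a')) [j j3 <-]; apply/matrixP => r t.
  by rewrite !ord1 -(wM w (Ordinal j3)) e !mxE.
exists w => //; apply/rowP => j; rewrite wM /= h ?mxE //.
by apply: mem_nth; case: j.
Qed.

Lemma veronese_chord w u v : (veronese w *m chord u v) 0 0 = bracket w u * bracket w v.
Proof. by rewrite mulmx33E !mxE /bracket /=; ring. Qed.

(** Gram matrix of the standard conic, and twice its inverse. *)
Definition gram : 'M[K]_3 := \matrix_(i < 3, j < 3)
  (nth [::] [:: [:: 0; 0; 1]; [:: 0; - 2%:R; 0]; [:: 1; 0; 0]] i)`_j.

Definition dual_gram : 'M[K]_3 := \matrix_(i < 3, j < 3)
  (nth [::] [:: [:: 0; 0; 2%:R]; [:: 0; - 1; 0]; [:: 2%:R; 0; 0]] i)`_j.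

Lemma gram_dual : gram *m dual_gram = 2%:R *: 1%:M.
Proof.
apply/matrixP => i j; rewrite mulmx33E.
by move: i j; do 2![apply: ord3_ind]; rewrite !mxE /=; ring.
Qed.

Lemma dual_gramE (a b : 'cV[K]_3) : (a^T *m dual_gram *m b) 0 0 =
  2%:R * (a 0 0 * b 2%:R 0 + a 2%:R 0 * b 0 0) - a 1 0 * b 1 0.
Proof. by rewrite mulmx33E !mulmx33E !mxE /=; ring. Qed.

Lemma bracket_self v : bracket v v = 0.
Proof. by rewrite /bracket mulrC subrr. Qed.

Lemma chordC u v : chord u v = chord v u.
Proof. by apply/colP; apply: ord3_ind; rewrite !mxE /=; ring. Qed.

Lemma chord_neq0 u v : bracket u v != 0 -> chord u v != 0.
Proof.
apply: contraNneq => c0.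
have e i : chord u v i 0 = 0 by rewrite c0 mxE.
have := e 0; have := e 1; have := e 2%:R; rewrite !mxE /= => e2 e1 e0.
rewrite -sqrf_eq0; apply/eqP.
transitivity ((- (u 0 0 * v 0 1 + u 0 1 * v 0 0)) ^+ 2
   - 4%:R * (u 0 0 * v 0 0) * (u 0 1 * v 0 1)); first by rewrite /bracket; ring.
by rewrite e0 e1 e2 expr0n /= !mulr0 subrr.
Qed.

End Bracket.

Section ProjectiveLine.
Variable K : fieldType.
Implicit Types (u v w : 'rV[K]_2) (N : 'M[K]_2).

Lemma rV2P u v : u 0 0 = v 0 0 -> u 0 1 = v 0 1 -> u = v.
Proof.
move=> e0 e1; apply/rowP => i.
have : (i == 0) || (i == 1) by case: i => [[|[|]] ?].
by case/orP => /eqP ->.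
Qed.

Lemma mul_rV2 v N : forall j, (v *m N) 0 j = v 0 0 * N 0 j + v 0 1 * N 1 j.
Proof.
move=> j; rewrite mxE !big_ord_recr big_ord0 /= add0r.
by congr (_ * _ + _ * _); congr (_ _ _); apply: val_inj.
Qed.

Lemma bracket_mul u v N : bracket (u *m N) (v *m N) = \det N * bracket u v.
Proof. by rewrite /bracket !mul_rV2 det2; ring. Qed.

Lemma bracketZl a u v : bracket (a *: u) v = a * bracket u v.
Proof. by rewrite /bracket !mxE; ring. Qed.

Lemma bracketZr a u v : bracket u (a *: v) = a * bracket u v.
Proof. by rewrite /bracket !mxE; ring. Qed.

Lemma bracketC u v : bracket u v = - bracket v u.
Proof. by rewrite /bracket; ring. Qed.

Lemma bracket_eq0 u v : u != 0 -> v != 0 -> bracket u v = 0 ->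
  exists2 c, c != 0 & v = c *: u.
Proof.
move=> u0 v0 e; suff [c ec] : exists c, v = c *: u.
  by exists c => //; apply: contraNneq v0 => c0; rewrite ec c0 scale0r.
have [z0|z0] := eqVneq (u 0 0) 0.
  have z1 : u 0 1 != 0.
    by apply: contraNneq u0 => z1; apply/eqP/rV2P; rewrite ?z0 ?z1 mxE.
  exists (v 0 1 / u 0 1); apply: rV2P; rewrite mxE ?divfK // z0 mulr0.
  apply/eqP; move/eqP: e; rewrite /bracket z0 mul0r sub0r oppr_eq0 mulf_eq0.
  by rewrite (negPf z1).
exists (v 0 0 / u 0 0); apply: rV2P; rewrite mxE ?divfK //.
apply: (mulfI z0); rewrite mulrA mulrCA divff // mulr1 [RHS]mulrC.
by apply/eqP; rewrite -subr_eq0 -e; apply/eqP; rewrite /bracket; ring.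
Qed.

Lemma veroneseZ a v : veronese (a *: v) = a ^+ 2 *: veronese v.
Proof. by apply/rowP; apply: ord3_ind; rewrite !mxE /=; ring. Qed.

Lemma three_points u v w :
  bracket u v != 0 -> bracket u w != 0 -> bracket v w != 0 ->
  exists2 N : 'M[K]_2, N \in unitmx & exists a b c, [/\ [&& a != 0, b != 0 & c != 0],
    u = a *: (hcoord 1 0 *m N), v = b *: (hcoord 0 1 *m N) & w = c *: (hcoord 1 1 *m N)].
Proof.
move=> uv uw vw.
pose a := - bracket v w; pose b := bracket u w; pose c := bracket u v.
have a0 : a != 0 by rewrite oppr_eq0.
pose N : 'M[K]_2 := \matrix_(i < 2, j < 2) if i == 0 then a * u 0 j else b * v 0 j.
have dN : \det N = a * b * bracket u v by rewrite det2 !mxE /= /bracket; ring.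
exists N.
  by rewrite unitmxE unitfE dN !mulf_neq0.
exists a^-1, b^-1, c^-1; split; first by rewrite !invr_eq0 a0 uw.
- by apply: rV2P; rewrite mxE mul_rV2 !mxE /=; field.
- by apply: rV2P; rewrite mxE mul_rV2 !mxE /=; field.
by apply: rV2P; rewrite mxE mul_rV2 !mxE /= /a /b /c /bracket; field.
Qed.

(** The action of [N] on the Veronese conic. *)
Definition sym2 N : 'M[K]_3 :=
  \matrix_(i < 3, j < 3) (nth [::]
   [:: [:: N 0 0 ^+ 2; N 0 0 * N 0 1; N 0 1 ^+ 2];
       [:: 2%:R * N 0 0 * N 1 0; N 0 0 * N 1 1 + N 0 1 * N 1 0; 2%:R * N 0 1 * N 1 1];
       [:: N 1 0 ^+ 2; N 1 0 * N 1 1; N 1 1 ^+ 2]] i)`_j.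

Lemma veronese_mul v N : veronese (v *m N) = veronese v *m sym2 N.
Proof.
have e0 := mul_rV2 v N 0; have e1 := mul_rV2 v N 1.
move: (v *m N) e0 e1 => z e0 e1.
apply/rowP => j; rewrite mulmx33E; move: j; apply: ord3_ind;
  by rewrite !mxE e0 e1 /=; ring.
Qed.

Lemma sym2_unit N : N \in unitmx -> sym2 N \in unitmx.
Proof.
rewrite !unitmxE !unitfE; apply: contraNneq => /eqP.
have -> : \det (sym2 N) = \det N ^+ 3 by rewrite det3 det2 !mxE /=; ring.
by rewrite expf_eq0.
Qed.

End ProjectiveLine.

(** * Joubert's invariants of a sextuple in normal position *)

Section Frame.
Variable K : numFieldType.
Variables d e f : K.

Definition frame_s (l : letter) : K :=
  match l with A => 1 | B => 0 | C => 1 | D => d | E => e | F => f end.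

Definition frame_t (l : letter) : K := if l is A then 0 else 1.

Definition frame (l : letter) : 'rV[K]_2 := hcoord (frame_s l) (frame_t l).

Lemma bracket_frame a b : bracket (frame a) (frame b) =
  frame_s a * frame_t b - frame_t a * frame_s b.
Proof. by rewrite /bracket !mxE. Qed.

Lemma chord_frame a b (j : 'I_3) : chord (frame a) (frame b) j 0 =
  [:: frame_t a * frame_t b; - (frame_s a * frame_t b + frame_t a * frame_s b);
      frame_s a * frame_s b]`_j.
Proof. by rewrite !mxE. Qed.

(** [joubert i + joubert j] is, up to sign, twice the product of the three
    brackets of the syntheme [ij] ([joubertD]); this determines the six
    values. *)
Definition joubert (i : nat) : K :=
  [:: 0;
      - d * e + d * f - d + e * f + e - f;
      d * e + d * f - d - e * f - e + f;
      d * e - d * f + d + e * f - e - f;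
      - d * e + d * f + d - e * f + e - f;
      d * e - d * f - d - e * f + e + f;
      - d * e - d * f + d + e * f - e + f]`_i.

(** Write [C_ij] for the product of the three chords of the syntheme [ij].  All
    these cubics restrict to the same form on the conic, so that
    [C_ij - C_12] is the product of the equation of the conic and of a linear
    form [phi_ij].  The forms below, one for each [i], are determined by
    [xi_i + xi_j = (n_i + n_j) phi_ij]. *)
Definition cubic_coef (i j : nat) : K :=
  (nth [::] [:: [::];
      [:: - d * e ^+ 2 + d * f + e ^+ 2 * f + e ^+ 2 - 2%:R * e * f;
          d ^+ 2 * e ^+ 2 - d ^+ 2 * e * f - d ^+ 2 * e + d * e * f ^+ 2
            + 2%:R * d * e * f + d * e - d * f ^+ 2 - d * f - e ^+ 2 * f ^+ 2
            - e ^+ 2 + f ^+ 2;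
          d ^+ 2 * e * f - 2%:R * d * e ^+ 2 * f + e ^+ 2 * f ^+ 2 + e ^+ 2 * f
            - e * f ^+ 2];
      [:: d * e ^+ 2 - d * f - e ^+ 2 * f - e ^+ 2 + 2%:R * e * f;
          - d ^+ 2 * e ^+ 2 + d ^+ 2 * e * f + d ^+ 2 * e - d * e * f ^+ 2
            - 2%:R * d * e * f - d * e + d * f ^+ 2 + d * f + e ^+ 2 * f ^+ 2
            + e ^+ 2 - f ^+ 2;
          - d ^+ 2 * e * f + 2%:R * d * e ^+ 2 * f - e ^+ 2 * f ^+ 2 - e ^+ 2 * f
            + e * f ^+ 2];
      [:: d * e ^+ 2 - 2%:R * d * e * f + d * f + e ^+ 2 * f - e ^+ 2;
          - d ^+ 2 * e ^+ 2 + d ^+ 2 * e * f + d ^+ 2 * e + d * e * f ^+ 2 - d * e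
            - d * f ^+ 2 - d * f - e ^+ 2 * f ^+ 2 + e ^+ 2 + f ^+ 2;
          - d ^+ 2 * e * f + 2%:R * d * e * f + e ^+ 2 * f ^+ 2 - e ^+ 2 * f
            - e * f ^+ 2];
      [:: - d * e ^+ 2 + 2%:R * d * e * f - d * f - e ^+ 2 * f + e ^+ 2;
          d ^+ 2 * e ^+ 2 - d ^+ 2 * e * f - d ^+ 2 * e + 2%:R * d ^+ 2 * f
            - d * e * f ^+ 2 + d * e - d * f ^+ 2 - d * f + e ^+ 2 * f ^+ 2 - e ^+ 2
            + f ^+ 2;
          - d ^+ 2 * e * f + 2%:R * d * e * f ^+ 2 - e ^+ 2 * f ^+ 2 + e ^+ 2 * f
            - e * f ^+ 2];
      [:: d * e ^+ 2 - 2%:R * d * e + d * f - e ^+ 2 * f + e ^+ 2;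
          - d ^+ 2 * e ^+ 2 + d ^+ 2 * e * f + d ^+ 2 * e - 2%:R * d ^+ 2 * f
            - d * e * f ^+ 2 + d * e + d * f ^+ 2 + d * f + e ^+ 2 * f ^+ 2 - e ^+ 2
            - f ^+ 2;
          d ^+ 2 * e * f - 2%:R * d * e * f - e ^+ 2 * f ^+ 2 + e ^+ 2 * f
            + e * f ^+ 2];
      [:: - d * e ^+ 2 + 2%:R * d * e - d * f + e ^+ 2 * f - e ^+ 2;
          d ^+ 2 * e ^+ 2 - d ^+ 2 * e * f - d ^+ 2 * e + d * e * f ^+ 2 - d * e
            + d * f ^+ 2 + d * f - e ^+ 2 * f ^+ 2 + e ^+ 2 - f ^+ 2;
          d ^+ 2 * e * f - 2%:R * d * e * f ^+ 2 + e ^+ 2 * f ^+ 2 - e ^+ 2 * f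
            + e * f ^+ 2]] i)`_j.

Definition cubic_form (i : nat) : 'cV[K]_3 := \col_(j < 3) cubic_coef i j.

Lemma joubert_sum : \sum_(i <- SIX) joubert i = 0.
Proof. by rewrite /SIX !big_cons big_nil /joubert /=; ring. Qed.

Lemma joubert_sum3 : \sum_(i <- SIX) joubert i ^+ 3 = 0.
Proof. by rewrite /SIX !big_cons big_nil /joubert /=; ring. Qed.

Lemma cubic_form_sum : \sum_(i <- SIX) cubic_form i = 0.
Proof.
by rewrite /SIX !big_cons big_nil; apply/colP; apply: ord3_ind;
  rewrite !mxE /cubic_coef /=; ring.
Qed.

Lemma cubic_form_sum_n2 : \sum_(i <- SIX) joubert i ^+ 2 *: cubic_form i = 0.
Proof.
by rewrite /SIX !big_cons big_nil; apply/colP; apply: ord3_ind;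
  rewrite !mxE /cubic_coef /joubert /=; ring.
Qed.

Hypothesis frame_distinct : forall a b, a != b -> bracket (frame a) (frame b) != 0.

Lemma joubertD i j : i \in SIX -> j \in SIX -> i != j ->
  exists s : bool, joubert i + joubert j =
    (-1) ^+ s * 2%:R * \prod_(p <- syntheme i j) bracket (frame p.1) (frame p.2).
Proof.
rewrite /SIX !inE.
by case/or4P=> [/eqP->|/eqP->|/eqP->|/or3P []/eqP->];
   case/or4P=> [/eqP->|/eqP->|/eqP->|/or3P []/eqP->] //= _;
   rewrite /syntheme /= !big_cons big_nil !bracket_frame /joubert /=;
   ((by exists false; ring) || (by exists true; ring)).
Qed.

(** Hence [n_i = n_j] if and only if the pairs of the syntheme [ij] are in
    involution. *)
Lemma joubertB i j : i \in SIX -> j \in SIX -> i != j ->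
  exists s : bool, joubert i - joubert j =
    (-1) ^+ s * 2%:R *
    (let p k := nth (A, A) (syntheme i j) k in
     involution (frame (p 0).1) (frame (p 0).2) (frame (p 1).1) (frame (p 1).2)
                (frame (p 2).1) (frame (p 2).2))%N.
Proof.
rewrite /SIX !inE.
by case/or4P=> [/eqP->|/eqP->|/eqP->|/or3P []/eqP->];
   case/or4P=> [/eqP->|/eqP->|/eqP->|/or3P []/eqP->] //= _;
   rewrite /syntheme /= /involution !bracket_frame /joubert /=;
   ((by exists false; ring) || (by exists true; ring)).
Qed.

Lemma side_form_coef i j k l m : side_form joubert cubic_form i j k l m 0 =
  (joubert k + joubert l) * (cubic_coef i m + cubic_coef j m)
  - (joubert i + joubert j) * (cubic_coef k m + cubic_coef l m).
Proof. by rewrite /side_form !mxE. Qed.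

(** On the chord [ab] all the products [C_ij] with [ij] in its label vanish, so
    that their forms [phi_ij] agree there; this is why [side_form] is
    a multiple of the chord.  The factor is, up to sign, four times the product
    of the square of the bracket of [ab] and of the six brackets of the other four
    points. *)
Lemma side_chord e0 : e0 \in labelling ->
  exists2 c, c != 0 &
  let p := nth (0, 0)%N e0.2 0 in let q := nth (0, 0)%N e0.2 1 in
  side_form joubert cubic_form p.1 p.2 q.1 q.2 =
  c *: chord (frame e0.1.1) (frame e0.1.2).
Proof.
pose B s i j := bracket (frame (nth A s i)) (frame (nth A s j)).
pose vd s := B s 0 1 * B s 0 2 * B s 0 3 * B s 1 2 * B s 1 3 * B s 2 3.
pose co (ab : letter * letter) := [seq l <- letters | l \notin [:: ab.1; ab.2]].
pose c ab := 4%:R * bracket (frame ab.1) (frame ab.2) ^+ 2 * vd (co ab).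
have c0 : all (fun e => (e.1.1 != e.1.2) &&
    uniq (co e.1) && (size (co e.1) == 4)) labelling by [].
move=> e0L; have c_neq0 : c e0.1 != 0.
  have /andP [/andP [ab uco] /eqP sco] := allP c0 _ e0L.
  have Bn i j : (i < 4)%N -> (j < 4)%N -> i != j -> B (co e0.1) i j != 0.
    by move=> i4 j4 ij; rewrite frame_distinct // nth_uniq ?sco.
  by rewrite /c /vd !mulf_eq0 pnatr_eq0 /= !negb_or frame_distinct ?Bn.
suff [s hs] : exists s : bool,
    let p := nth (0, 0)%N e0.2 0 in let q := nth (0, 0)%N e0.2 1 in
    side_form joubert cubic_form p.1 p.2 q.1 q.2 =
    ((-1) ^+ s * c e0.1) *: chord (frame e0.1.1) (frame e0.1.2).
  by exists ((-1) ^+ s * c e0.1); rewrite // mulf_neq0 ?signr_eq0.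
move: e0L {c0 c_neq0}; rewrite /labelling !inE.
by do 14?[case/orP]; move=> /eqP ->; rewrite /c /vd /B /co !bracket_frame;
  ((by exists false; apply/colP; apply: ord3_ind;
     rewrite side_form_coef [RHS]mxE chord_frame /cubic_coef /joubert /=; ring) ||
   (by exists true; apply/colP; apply: ord3_ind;
     rewrite side_form_coef [RHS]mxE chord_frame /cubic_coef /joubert /=; ring)).
Qed.

Definition dual_form (a b : 'cV[K]_3) : K :=
  2%:R * (a 0 0 * b 2%:R 0 + a 2%:R 0 * b 0 0) - a 1 0 * b 1 0.

Lemma salmon_coef x y z m : salmon_form joubert cubic_form x y z m 0 =
  (joubert y - joubert z) * cubic_coef x m + (joubert z - joubert x) * cubic_coef y m
  + (joubert x - joubert y) * cubic_coef z m.
Proof. by rewrite /salmon_form !mxE. Qed.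

Definition ten_splits : seq (seq nat) :=
  [:: [:: 1; 2; 3; 4; 5; 6]; [:: 1; 2; 4; 3; 5; 6]; [:: 1; 2; 5; 3; 4; 6];
      [:: 1; 2; 6; 3; 4; 5]; [:: 1; 3; 4; 2; 5; 6]; [:: 1; 3; 5; 2; 4; 6];
      [:: 1; 3; 6; 2; 4; 5]; [:: 1; 4; 5; 2; 3; 6]; [:: 1; 4; 6; 2; 3; 5];
      [:: 1; 5; 6; 2; 3; 4]]%N.

Definition ordered_split (s : seq nat) : bool :=
  if s is [:: x; y; z; u; v; w] then [&& x <= y <= z, u <= v <= w & x <= u]%N else false.

Lemma ordered_splitP s : perm_eq s SIX -> ordered_split s -> s \in ten_splits.
Proof.
have H : all (fun s => ordered_split s ==> (s \in ten_splits)) (permutations SIX).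
  by vm_compute.
by rewrite -mem_permutations => /(allP H) /implyP.
Qed.

Lemma sorted3_ind (R : nat -> nat -> nat -> Prop) :
  (forall x y z, R x y z -> R y x z) -> (forall x y z, R x y z -> R x z y) ->
  (forall x y z, (x <= y <= z)%N -> R x y z) -> forall x y z, R x y z.
Proof.
move=> s12 s23 hR x y z.
wlog xy : x y z / (x <= y)%N => [W|].
  by have [/W|/ltnW /W] := leqP x y; [apply | move/(_ z)/s12].
have [yz|/ltnW zy] := leqP y z; first by apply: hR; rewrite xy.
have [xz|/ltnW zx] := leqP x z; first by apply/s23/hR; rewrite xz.
by apply/s23/s12/hR; rewrite zx.
Qed.

(** Both sides are alternating in each block and symmetric under the exchange of
    the blocks, which leaves ten identities between polynomials in
    [d, e, f]. *)
Lemma salmon_polar x y z u v w : perm_eq [:: x; y; z; u; v; w] SIX ->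
  4%:R * dual_form (salmon_form joubert cubic_form x y z)
    (salmon_form joubert cubic_form u v w) = disc joubert x y z * disc joubert u v w.
Proof.
rewrite /dual_form /disc !salmon_coef.
move: u v w x y z; apply: sorted3_ind => [u v w IH x y z p|u v w IH x y z p|u v w uvw].
- have p' : perm_eq [:: x; y; z; u; v; w] SIX by reorder p.
  by apply: oppr_inj; apply: etrans (etrans _ (IH _ _ _ p')) _; ring.
- have p' : perm_eq [:: x; y; z; u; v; w] SIX by reorder p.
  by apply: oppr_inj; apply: etrans (etrans _ (IH _ _ _ p')) _; ring.
apply: sorted3_ind => [x y z IH p|x y z IH p|x y z xyz].
- have p' : perm_eq [:: x; y; z; u; v; w] SIX by reorder p.
  by apply: oppr_inj; apply: etrans (etrans _ (IH p')) _; ring.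
- have p' : perm_eq [:: x; y; z; u; v; w] SIX by reorder p.
  by apply: oppr_inj; apply: etrans (etrans _ (IH p')) _; ring.
wlog xu : x y z u v w uvw xyz / (x <= u)%N => [W p|p].
  have p' : perm_eq [:: u; v; w; x; y; z] SIX by reorder p.
  have [xu|/ltnW ux] := leqP x u; first exact: W.
  by rewrite [RHS]mulrC -(W u v w x y z) //; ring.
have := ordered_splitP p; rewrite /= uvw xyz xu => /(_ isT).
rewrite /ten_splits !inE.
by do 9?[case/orP]; move=> /eqP [-> -> -> -> -> ->];
  rewrite /cubic_coef /joubert /=; ring.
Qed.

(** The sums of the [joubert i] and of the [cubic_form i] vanish. *)
Lemma side_form_cycle p1 p2 q1 q2 r1 r2 :
  perm_eq [:: p1; p2; q1; q2; r1; r2] SIX ->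
  side_form joubert cubic_form q1 q2 r1 r2 = side_form joubert cubic_form p1 p2 q1 q2.
Proof.
move=> p; have en := joubert_sum; rewrite (sum_SIX _ p) in en.
have ex := cubic_form_sum; rewrite (sum_SIX _ p) in ex.
apply/colP => m; rewrite !side_form_coef.
have /colP/(_ m) := ex; rewrite !mxE => em.
have er : joubert r1 = - (joubert p1 + joubert p2 + joubert q1 + joubert q2 + joubert r2).
  by apply/eqP; rewrite -subr_eq0 -en; apply/eqP; ring.
have fr : cubic_coef r1 m = - (cubic_coef p1 m + cubic_coef p2 m + cubic_coef q1 m
                               + cubic_coef q2 m + cubic_coef r2 m).
  by apply/eqP; rewrite -subr_eq0 -em; apply/eqP; ring.
rewrite er fr; ring.
Qed.

Lemma side_formC i j k l :
  [/\ side_form joubert cubic_form j i k l = side_form joubert cubic_form i j k l,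
      side_form joubert cubic_form i j l k = side_form joubert cubic_form i j k l
    & side_form joubert cubic_form k l i j = - side_form joubert cubic_form i j k l].
Proof.
split; rewrite /side_form ?opprB // ?[joubert j + _]addrC ?[cubic_form j + _]addrC //.
by rewrite [joubert l + _]addrC [cubic_form l + _]addrC.
Qed.

Lemma side_form_label a b i j k l :
  contains (label a b) i j -> contains (label a b) k l -> i \notin [:: k; l] ->
  exists2 c, c != 0 &
    side_form joubert cubic_form i j k l = c *: chord (frame a) (frame b).
Proof.
rewrite /label; set m := find _ _; set e0 := nth _ _ _.
have [m15|m15] := ltnP m (size labelling); last first.
  by rewrite /e0 nth_default.
have e0L : e0 \in labelling by exact: mem_nth.
have chordE : chord (frame e0.1.1) (frame e0.1.2) = chord (frame a) (frame b).
  have : joins a b e0 by apply: nth_find; rewrite has_find.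
  by case/orP => /eqP -> //=; exact: chordC.
have [c c0] := side_chord e0L; rewrite chordE => /=.
have : perm_eq (flatten [seq [:: p.1; p.2] | p <- e0.2]) SIX && (size e0.2 == 3).
  have : all (fun e => perm_eq (flatten [seq [:: p.1; p.2] | p <- e.2]) SIX
     && (size e.2 == 3)) labelling by [].
  by move/allP; apply.
case: e0.2 => [|[p1 p2] [|[q1 q2] [|[r1 r2] [|? ?]]]] //=; rewrite ?andbF // andbT => p.
move=> e1; have e2 := side_form_cycle p.
have p' : perm_eq [:: q1; q2; r1; r2; p1; p2] SIX by reorder p.
have e3 := side_form_cycle p'.
have key x y : x \in [:: (p1, p2); (q1, q2); (r1, r2)] ->
    y \in [:: (p1, p2); (q1, q2); (r1, r2)] -> x != y ->
    exists2 c', c' != 0 & side_form joubert cubic_form x.1 x.2 y.1 y.2 =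
                          c' *: chord (frame a) (frame b).
  have flip i' j' k' l' :
      side_form joubert cubic_form i' j' k' l' = c *: chord (frame a) (frame b) ->
      exists2 c', c' != 0 & side_form joubert cubic_form k' l' i' j' =
                            c' *: chord (frame a) (frame b).
    move=> h; exists (- c); first by rewrite oppr_eq0.
    by have [_ _ ->] := side_formC i' j' k' l'; rewrite h scaleNr.
  rewrite !inE => /or3P [] /eqP -> /or3P [] /eqP ->; rewrite ?eqxx //= => _;
    by [exists c; rewrite // ?e3 ?e2 | apply: flip; rewrite ?e3 ?e2].
have pairP x y : contains [:: (p1, p2); (q1, q2); (r1, r2)] x y ->
    exists2 s, s \in [:: (p1, p2); (q1, q2); (r1, r2)] & s = (x, y) \/ s = (y, x).
  by case/orP => h; eexists; [exact: h|left|exact: h|right].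
move=> /pairP [s sL sij] /pairP [t tL tkl] ikl.
have st : s != t.
  apply: contraNneq ikl => st; rewrite !inE.
  by move: st; case: sij => ->; case: tkl => -> [e1' e2']; rewrite ?e1' ?e2' eqxx ?orbT.
have [c' c'0 e4] := key s t sL tL st; exists c' => //; rewrite -e4.
have [h1 h2 _] := side_formC i j k l; have [_ h3 _] := side_formC j i k l.
by case: sij tkl => -> [] ->; rewrite /= ?h3 ?h2 ?h1.
Qed.

End Frame.

(** * The hexahedral structure of a sextuple on a conic *)

Section Configuration.
Variables (K : numFieldType) (d e f : K) (Q M : 'M[K]_3) (c : K).
Variable G : letter -> {vspace 'rV[K]_3}.
Hypothesis frame_distinct :
  forall a b, a != b -> bracket (frame d e f a) (frame d e f b) != 0.
Hypotheses (hQ : nonsingular_conic Q) (uM : M \in unitmx) (c0 : c != 0).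
Hypothesis conicM : M *m Q *m M^T = c *: gram K.
Hypothesis Gframe : forall l, G l = <[veronese (frame d e f l) *m M]>%VS.

Lemma mem_chord u v w :
  (veronese w *m M \in line (invmx M *m chord u v)) = (bracket w u * bracket w v == 0).
Proof.
rewrite mem_line mulmxA mulmxK // -veronese_chord.
apply/eqP/eqP => [->|h]; first by rewrite mxE.
by apply/matrixP => i j; rewrite !ord1 h mxE.
Qed.

Lemma sub_chord a b :
  (G a + G b <= line (invmx M *m chord (frame d e f a) (frame d e f b)))%VS.
Proof.
by rewrite subv_add !Gframe -!memvE !mem_chord !bracket_self mul0r mulr0 eqxx.
Qed.

Lemma frame_neq0 l : frame d e f l != 0.
Proof.
have [m] : exists m, l != m by case: l; (by exists A) || by exists B.
move/frame_distinct; apply: contraNneq => ->.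
by rewrite /bracket !mxE !mul0r subrr.
Qed.

Lemma veronese_neq0 (v : 'rV[K]_2) : v != 0 -> veronese v *m M != 0.
Proof.
apply: contraNneq => /(congr1 (mulmx^~ (invmx M))); rewrite mulmxK // mul0mx => z.
have := congr1 (fun a : 'rV[K]_3 => a 0 0) z; have := congr1 (fun a : 'rV[K]_3 => a 0 2%:R) z.
rewrite !mxE /= => /eqP; rewrite sqrf_eq0 => /eqP z1 /eqP; rewrite sqrf_eq0 => /eqP z0.
by apply/eqP/rV2P; rewrite mxE.
Qed.

Lemma G_point l : is_point (G l).
Proof. by rewrite /is_point Gframe dim_vline veronese_neq0 ?frame_neq0. Qed.

Lemma G_triangle a b x : uniq [:: a; b; x] -> ~~ (G a <= G b + G x)%VS.
Proof.
rewrite /= !inE negb_or andbT => /andP [/andP [ab ax] _]; apply/negP => h.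
have := subv_trans h (sub_chord b x).
by rewrite Gframe -memvE mem_chord mulf_eq0 !(negPf (frame_distinct _)).
Qed.

Lemma dual_conic : (invmx M)^T *m invmx Q *m invmx M = (2%:R * c)^-1 *: dual_gram K.
Proof.
have [sQ uQ] := hQ; set X := _ *m _ *m _.
have XS : X *m (M *m Q *m M^T) = 1%:M.
  rewrite /X !mulmxA mulmxKV // mulmxKV // -trmx_mul mulmxV //.
  by rewrite trmx1.
have c2 : 2%:R * c != 0 by rewrite mulf_neq0 ?pnatr_eq0.
apply: (scalerI c2); rewrite scalerA divff // scale1r.
transitivity (X *m (M *m Q *m M^T) *m dual_gram K); last by rewrite XS mul1mx.
rewrite conicM -mulmxA -scalemxAl gram_dual scalerA mulrC -scalemxAr mulmx1.
by [].
Qed.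

Lemma frame_hexahedral :
  hexahedral (joubert d e f) (fun i => invmx M *m cubic_form d e f i) Q G.
Proof.
have side_mul i j k l :
    side_form (joubert d e f) (fun i => invmx M *m cubic_form d e f i) i j k l =
    invmx M *m side_form (joubert d e f) (cubic_form d e f) i j k l.
  by rewrite /side_form mulmxBr -!scalemxAr !mulmxDr.
have salmon_mul x y z :
    salmon_form (joubert d e f) (fun i => invmx M *m cubic_form d e f i) x y z =
    invmx M *m salmon_form (joubert d e f) (cubic_form d e f) x y z.
  by rewrite /salmon_form !mulmxDr -!scalemxAr.
split.
- exact: joubert_sum.
- exact: joubert_sum3.
- by rewrite -mulmx_sumr cubic_form_sum mulmx0.
- under eq_bigr do rewrite scalemxAr.
  by rewrite -mulmx_sumr cubic_form_sum_n2 mulmx0.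
- move=> i j iS jS ij; have [s ->] := joubertD d e f iS jS ij.
  rewrite !mulf_neq0 ?signr_eq0 ?pnatr_eq0 // prodf_seq_neq0.
  have lab : all (fun e => e.1.1 != e.1.2) labelling by [].
  apply/allP => p /mapP [x]; rewrite mem_filter => /andP [_ /(allP lab) xx] ->.
  by apply/implyP => _; exact: frame_distinct.
- exact: G_point.
- exact: G_triangle.
- move=> a b i j k l c1 c2 ikl.
  have [c' c'0 ec] := side_form_label frame_distinct c1 c2 ikl.
  have ab : a != b by apply: contraTneq c1 => ->; rewrite label_diag.
  have le : line (side_form (joubert d e f) (fun i => invmx M *m cubic_form d e f i) i j k l)
     = line (invmx M *m chord (frame d e f a) (frame d e f b)).
    apply/vspaceP => v; rewrite !mem_line side_mul ec -!scalemxAr.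
    by rewrite scaler_eq0 (negPf c'0).
  rewrite le; apply: line_eq; rewrite ?sub_chord //.
    apply: contraNneq (chord_neq0 (frame_distinct ab)) => h.
    by rewrite -[chord _ _](mulKVmx uM) h mulmx0.
  by rewrite (dim_side G_point G_triangle ab).
exists ((2%:R * c)^-1 / 4%:R).
  by rewrite mulf_neq0 ?invr_eq0 ?mulf_neq0 ?pnatr_eq0.
move=> x y z u v w p; rewrite -(salmon_polar d e f p) !salmon_mul.
set g := salmon_form _ _ _ _ _; set h := salmon_form _ _ _ _ _.
have -> : (invmx M *m g)^T *m invmx Q *m (invmx M *m h) =
    g^T *m ((invmx M)^T *m invmx Q *m invmx M) *m h by rewrite trmx_mul !mulmxA.
rewrite dual_conic -scalemxAr -scalemxAl mxE dual_gramE /dual_form.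
by field.
Qed.

End Configuration.

Section Conic.
Variables (K : numFieldType) (Q M : 'M[K]_3).
Hypotheses (hQ : nonsingular_conic Q) (hM : conic_isomorphism Q M).

(** A quartic binary form that vanishes identically has zero coefficients; the
    values at [1 : 0], [0 : 1], [1 : 1], [1 : -1] and [1 : 2] suffice. *)
Lemma conic_gram : exists2 c, c != 0 & M *m Q *m M^T = c *: gram K.
Proof.
have [[sQ uQ] [uM iso]] := (hQ, hM).
have [S SE] : exists S, S = M *m Q *m M^T by exists (M *m Q *m M^T).
rewrite -SE.
have symS i j : S i j = S j i.
  have ST : S^T = S by rewrite SE !trmx_mul trmxK sQ mulmxA.
  by rewrite -{2}ST [RHS]mxE.
have val s t : s ^+ 4 * S 0 0 + 2%:R * s ^+ 3 * t * S 0 1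
    + s ^+ 2 * t ^+ 2 * (2%:R * S 0 2%:R + S 1 1) + 2%:R * s * t ^+ 3 * S 1 2%:R
    + t ^+ 4 * S 2%:R 2%:R = 0.
  have := iso (hcoord s t); rewrite /conic_form /quadratic_map -/(veronese _).
  rewrite trmx_mul -!mulmxA [M *m (Q *m _)]mulmxA [_ *m (M^T *m _)]mulmxA -SE.
  rewrite mulmxA mulmx33E !mulmx33E !mxE /= (symS 1 0) (symS 2%:R 0) (symS 2%:R 1) => <-.
  ring.
have S00 : S 0 0 = 0 by rewrite -[RHS](val 1 0); ring.
have S22 : S 2%:R 2%:R = 0 by rewrite -[RHS](val 0 1); ring.
have S11 : S 1 1 = - (2%:R * S 0 2%:R).
  apply: (@mulfI _ 2%:R); first by rewrite pnatr_eq0.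
  apply/eqP; rewrite -subr_eq0; apply/eqP.
  rewrite -[RHS](addr0 0) -{1}(val 1 1) -(val 1 (-1)) S00 S22; ring.
have S01 : S 0 1 = - S 1 2%:R.
  apply: (@mulfI _ 4%:R); first by rewrite pnatr_eq0.
  apply/eqP; rewrite -subr_eq0; apply/eqP.
  rewrite -[RHS](subr0 0) -{1}(val 1 1) -(val 1 (-1)) S00 S22; ring.
have S12 : S 1 2%:R = 0.
  apply: (@mulfI _ 12%:R); first by rewrite pnatr_eq0.
  rewrite mulr0 -(val 1 2%:R) S00 S22 S11 S01; ring.
have eS : S = S 0 2%:R *: gram K.
  apply/matrixP; do 2![apply: ord3_ind]; rewrite [RHS]mxE [gram _ _ _]mxE /=;
  rewrite ?S00 ?S22 ?S11 ?S01 ?(symS 1 0) ?(symS 2%:R 0) ?(symS 2%:R 1) ?S01 ?S12; ring.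
exists (S 0 2%:R) => //; apply/eqP => S02.
have uS : S \in unitmx by rewrite SE !unitmx_mul uM uQ unitmx_tr.
have := mulmxV uS; rewrite {1}eS S02 scale0r mul0mx => /matrixP/(_ 0 0)/eqP.
by rewrite !mxE eq_sym oner_eq0.
Qed.

End Conic.

Section NormalForm.
Variables (K : numFieldType) (Q M : 'M[K]_3) (G : letter -> {vspace 'rV[K]_3}).
Hypotheses (hQ : nonsingular_conic Q) (hM : conic_isomorphism Q M).
Hypotheses (hG : injective G) (hGQ : forall l, on_conic Q (G l)).

Lemma isotropic_veronese (u : 'rV[K]_3) : u != 0 -> conic_form Q u u = 0 ->
  exists2 v, v != 0 & <[u]>%VS = <[veronese v *m M]>%VS.
Proof.
move=> u0 iso; have [c c0 cM] := conic_gram hQ hM; have uM := hM.1.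
have [w wE] : exists w, w = u *m invmx M by exists (u *m invmx M).
have uE : u = w *m M by rewrite wE mulmxKV.
have w0 : w != 0 by apply: contraNneq u0 => w0; rewrite uE w0 mul0mx.
have w_conic : w 0 1 ^+ 2 = w 0 0 * w 0 2%:R.
  have := iso; rewrite uE /conic_form trmx_mul -!mulmxA.
  rewrite [M *m (Q *m _)]mulmxA [_ *m (M^T *m _)]mulmxA cM mulmxA.
  rewrite mulmx33E !mulmx33E !mxE /= => e.
  have c2 : - (2%:R * c) != 0 by rewrite oppr_eq0 mulf_neq0 ?pnatr_eq0.
  by apply: (mulfI c2); apply/eqP; rewrite -subr_eq0 -e; apply/eqP; ring.
have [z0|z0] := eqVneq (w 0 0) 0.
  have z1 : w 0 1 = 0 by apply/eqP; rewrite -sqrf_eq0 w_conic z0 mul0r.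
  have z2 : w 0 2%:R != 0.
    apply: contraNneq w0 => z2; apply/eqP/rowP; apply: ord3_ind; by rewrite ?z0 ?z1 ?z2 mxE.
  exists (hcoord 0 1).
    by apply/eqP => /rowP/(_ 1)/eqP; rewrite !mxE oner_eq0.
  rewrite uE; have -> : w = w 0 2%:R *: veronese (hcoord 0 1).
    by apply/rowP; apply: ord3_ind; rewrite !mxE /= ?z0 ?z1; ring.
  by rewrite -scalemxAl vlineZ.
exists (hcoord (w 0 0) (w 0 1)).
  by apply: contraNneq z0 => /rowP/(_ 0); rewrite !mxE => /eqP.
rewrite uE -(vlineZ _ z0) scalemxAl; congr <[_ *m M]>%VS.
by apply/rowP; apply: ord3_ind; rewrite !mxE /= ?w_conic; ring.
Qed.

Lemma parametrization : exists2 v : letter -> 'rV[K]_2,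
  (forall l, G l = <[veronese (v l) *m M]>%VS) &
  forall a b, a != b -> bracket (v a) (v b) != 0.
Proof.
have ex l : exists2 v, v != 0 & G l = <[veronese v *m M]>%VS.
  have [dG iso] := hGQ l.
  have p0 : vpick (G l) != 0 by rewrite vpick0 -dimv_eq0 dG.
  have [v v0 e] := isotropic_veronese p0 (iso _ (memv_pick _)); exists v => //.
  by rewrite -e; apply/esym/eqP; rewrite eqEdim -memvE memv_pick dG dim_vline p0.
have [v hv] : exists v : letter -> 'rV[K]_2,
    forall l, v l != 0 /\ G l = <[veronese (v l) *m M]>%VS.
  have [vA ? ?] := ex A; have [vB ? ?] := ex B; have [vC ? ?] := ex C.
  have [vD ? ?] := ex D; have [vE ? ?] := ex E; have [vF ? ?] := ex F.
  by exists (fun l => match l with A => vA | B => vB | C => vC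
                              | D => vD | E => vE | F => vF end); case.
exists v => [l|a b]; first by case: (hv l).
have [[a0 ea] [b0 eb]] := (hv a, hv b); apply: contraNneq => z.
have [c c0 e] := bracket_eq0 a0 b0 z; apply/eqP/hG.
by rewrite ea eb e veroneseZ -scalemxAl vlineZ // expf_neq0.
Qed.

(** The points [A], [B], [C] are moved to [oo], [0], [1]; the others then have
    finite coordinates [d], [e], [f]. *)
Lemma normal_form : exists d e f (N : 'M[K]_2),
  [/\ N \in unitmx,
      forall a b, a != b -> bracket (frame d e f a) (frame d e f b) != 0 &
      forall l, G l = <[veronese (frame d e f l *m N) *m M]>%VS].
Proof.
have [v Gv vn] := parametrization.
have [N uN [a [b [c [/and3P [a0 b0 c0] eA eB eC]]]]] :=
  three_points (vn A B isT) (vn A C isT) (vn B C isT).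
have fin l : l != A -> exists d, exists2 k, k != 0 & v l = k *: (hcoord d 1 *m N).
  move=> lA; have [x vE] : exists x, v l = x *m N.
    by exists (v l *m invmx N); rewrite mulmxKV.
  have x1 : x 0 1 != 0.
    have := vn _ _ lA; rewrite vE eA bracketZr bracket_mul !mulf_eq0 !negb_or.
    by case/and3P=> _ _; apply: contraNneq => z; rewrite /bracket !mxE /= z mul0r mulr0 subrr.
  exists (x 0 0 / x 0 1), (x 0 1) => //; rewrite vE scalemxAl; congr (_ *m N).
  by apply: rV2P; rewrite !mxE /= ?mulr1 // mulrC divfK.
have [d [kD kD0 eD]] := fin D isT; have [e [kE kE0 eE]] := fin E isT.
have [f [kF kF0 eF]] := fin F isT.
have fr l : exists2 k, k != 0 & v l = k *: (frame d e f l *m N).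
  by case: l; [exists a|exists b|exists c|exists kD|exists kE|exists kF].
exists d, e, f, N; split=> // [x y xy|l]; last first.
  by have [k k0 ek] := fr l; rewrite Gv ek veroneseZ -scalemxAl vlineZ // expf_neq0.
have := vn _ _ xy; have [k _ ->] := fr x; have [k' _ ->] := fr y.
by apply: contraNneq => z; rewrite bracketZl bracketZr bracket_mul z !mulr0.
Qed.

End NormalForm.

(** * Involutions and tri-involutive sextuples *)

(** The points of the model are numbered as [0, 1, oo, p, (p - 1) / p,
    1 / (1 - p)].  The map [x |-> 1 / (1 - x)] permutes the two halves cyclically,
    and each involution that conjugates it to its inverse and exchanges the halves
    gives one of these matchings. *)
Definition matchings : seq (seq (nat * nat)) :=
  [:: [:: (0, 3); (1, 4); (2, 5)]; [:: (0, 4); (1, 5); (2, 3)];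
      [:: (0, 5); (1, 3); (2, 4)]]%N.

(** The list [s] holds the letters of the six points of the model, in order. *)
Definition matched (s : seq letter) (i j : nat) : bool :=
  let syn := [seq (index p.1 s, index p.2 s) | p <- syntheme i j] in
  has (fun m => all (fun p => contains m p.1 p.2) syn) matchings.

(** The pair of indices common to the labels of [ab] and [cd], so that [ab] and
    [cd] belong to its syntheme. *)
Definition shared_duad (a b c d : letter) : nat * nat :=
  head (0, 0)%N [seq p <- label a b | contains (label c d) p.1 p.2].

(** The indices of the synthemes that the first two matchings become on the letters
    [s], with the shared index in the middle. *)
Definition model_triple (s : seq letter) : nat * nat * nat :=
  let l k := nth A s k in
  let p := shared_duad (l 0) (l 3) (l 1) (l 4) in
  let q := shared_duad (l 0) (l 4) (l 1) (l 5) in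
  let j := if (p.1 == q.1) || (p.1 == q.2) then p.1 else p.2 in
  (if p.1 == j then p.2 else p.1, j, if q.1 == j then q.2 else q.1)%N.

(** The outer automorphism of the symmetric group at work: three disjoint
    matchings whose pairwise products have order three correspond to three
    pairs [ij], [jk], [ik] of indices. *)
Lemma matched_triple s : perm_eq s letters ->
  exists i j k, [/\ uniq [:: i; j; k], {subset [:: i; j; k] <= SIX},
    matched s i j & matched s j k].
Proof.
have H : all (fun s => let: (i, j, k) := model_triple s in
    [&& uniq [:: i; j; k], all (mem SIX) [:: i; j; k], matched s i j & matched s j k])
    (permutations letters).
  by vm_compute.
rewrite -mem_permutations => /(allP H) {H}; case: (model_triple s) => [[i j] k].
by move=> /and4P [u /allP S m1 m2]; exists i, j, k.
Qed.

Definition partner (s : seq (letter * letter)) (a : letter) : letter :=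
  head A ([seq p.2 | p <- s & p.1 == a] ++ [seq p.1 | p <- s & p.2 == a]).

(** The union of two synthemes [ij] and [jk] is a hexagon; its vertices are
    listed from [A], going alternately along the two matchings. *)
Lemma triple_hexad i j k : uniq [:: i; j; k] -> {subset [:: i; j; k] <= SIX} ->
  exists l1 l2 l3 l4 l5 l6, perm_eq [:: l1; l2; l3; l4; l5; l6] letters /\
    let joined s a b := ((a, b) \in s) || ((b, a) \in s) in
    [&& joined (syntheme i j) l1 l4, joined (syntheme i j) l2 l5,
        joined (syntheme i j) l3 l6, joined (syntheme j k) l1 l5,
        joined (syntheme j k) l2 l6 & joined (syntheme j k) l3 l4].
Proof.
have H : all (fun i => all (fun j => all (fun k => if uniq [:: i; j; k] then
  let s := syntheme i j in let t := syntheme j k in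
  let l4 := partner s A in let l5 := partner t A in let l2 := partner s l5 in
  let l6 := partner t l2 in let l3 := partner s l6 in
  perm_eq [:: A; l2; l3; l4; l5; l6] letters &&
    (let joined s a b := ((a, b) \in s) || ((b, a) \in s) in
    [&& joined s A l4, joined s l2 l5, joined s l3 l6, joined t A l5,
        joined t l2 l6 & joined t l3 l4]) else true) SIX) SIX) SIX.
  by vm_compute.
move=> u S; have [iS jS kS] : [/\ i \in SIX, j \in SIX & k \in SIX].
  by split; apply: S; rewrite !inE eqxx ?orbT.
have := allP (allP (allP H i iS) j jS) k kS; rewrite u => /andP [p h].
by do 6![eexists]; split; [exact: p | exact: h].
Qed.

Section TriInvolutive.
Variable K : numFieldType.

Definition concurrent (s : seq ('rV[K]_2 * 'rV[K]_2)) : Prop :=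
  exists2 w : 'rV[K]_3, w != 0 & forall p, p \in s -> w *m chord p.1 p.2 = 0.

Lemma concurrent_sub s t : concurrent s ->
  (forall q, q \in t -> exists p c, p \in s /\ chord q.1 q.2 = c *: chord p.1 p.2) ->
  concurrent t.
Proof.
move=> [w w0 h] st; exists w => // q /st [p [c [ps ->]]].
by rewrite -scalemxAr h ?scaler0.
Qed.

Lemma chordZ (a b : K) (u v : 'rV[K]_2) : chord (a *: u) (b *: v) = (a * b) *: chord u v.
Proof. by apply/colP; apply: ord3_ind; rewrite !mxE /=; ring. Qed.

Lemma involutionZ (a b c : K) u u' v v' w w' :
  involution (a *: u) u' (b *: v) v' (c *: w) w' = a * b * c * involution u u' v v' w w'.
Proof. by rewrite /involution !bracketZl !bracketZr; ring. Qed.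

Lemma involution_mul (N : 'M[K]_2) a a' b b' c c' :
  involution (a *m N) (a' *m N) (b *m N) (b' *m N) (c *m N) (c' *m N) =
  \det N ^+ 3 * involution a a' b b' c c'.
Proof. by rewrite /involution !bracket_mul; ring. Qed.

Lemma model_matching (p : 'rV[K]_2) (N : 'M[K]_2) m : m \in matchings ->
  concurrent [seq (let q k := nth 0 (tri_involutive_model p) k *m N in (q x.1, q x.2))
    | x <- m].
Proof.
rewrite !inE => hm; case/or3P: hm => /eqP -> /=;
  apply/involutionP; rewrite involution_mul /involution /bracket !mxE /=; ring.
Qed.

End TriInvolutive.

(** The two involutions give two bilinear equations for [u] and [v].  Eliminating
    [u] leaves a quadratic equation for [v], with the roots [p] and
    [1 / (1 - p)]; the first one is excluded. *)
Lemma second_orbit_points (K : fieldType) (p u v : 'rV[K]_2) :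
  involution (hcoord 0 1) p (hcoord 1 1) u (hcoord 1 0) v = 0 ->
  involution (hcoord 0 1) u (hcoord 1 1) v (hcoord 1 0) p = 0 ->
  u != 0 -> bracket p v != 0 -> bracket (hcoord 0 1) v != 0 ->
  bracket u (hcoord (p 0 0 - p 0 1) (p 0 0)) = 0 /\
  bracket v (hcoord (p 0 1) (p 0 1 - p 0 0)) = 0.
Proof.
set s := p 0 0; set t := p 0 1; pose x := u 0 0; pose y := u 0 1.
pose x' := v 0 0; pose y' := v 0 1.
rewrite /involution /bracket !mxE /= -/s -/t -/x -/y -/x' -/y' => e1 e2 u0 pv zv.
pose L1 : K := x * (t * (x' - y')) - y * ((s - t) * x').
pose L2 : K := y * ((s - t) * x' + s * y') - x * (s * y').
have l1 : L1 = 0 by rewrite -e1 /L1; ring.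
have l2 : L2 = 0 by rewrite -e2 /L2; ring.
(* The determinant of the two equations, which are linear in (x, y). *)
have dvd : (s * y' - t * x') * ((s - t) * x' + t * y') = 0.
  have xy : (x != 0) || (y != 0).
    apply: contraR u0; rewrite negb_or !negbK => /andP [/eqP zx /eqP zy].
    by apply/eqP/rV2P; rewrite mxE.
  case/orP: xy => h; apply: (mulfI h); rewrite mulr0.
  - transitivity (- (((s - t) * x' + s * y') * L1 + (s - t) * x' * L2)).
      by rewrite /L1 /L2; ring.
    by rewrite l1 l2 !mulr0 addr0 oppr0.
  - transitivity (- (s * y' * L1 + t * (x' - y') * L2)).
      by rewrite /L1 /L2; ring.
    by rewrite l1 l2 !mulr0 addr0 oppr0.
have ev : (s - t) * x' + t * y' = 0.
  by apply: (mulfI pv); rewrite mulr0 -[RHS]dvd.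
split; last by rewrite -[RHS]oppr0 -ev; ring.
apply: (mulIf zv); rewrite [RHS]mul0r.
transitivity (- (L1 + x * ((s - t) * x' + t * y'))); first by rewrite /L1; ring.
by rewrite l1 ev mulr0 addr0 oppr0.
Qed.

Section Equivalence.
Variables (K : numFieldType) (Q M : 'M[K]_3) (G : letter -> {vspace 'rV[K]_3}).
Variables (d e f : K) (N : 'M[K]_2).
Hypotheses (hQ : nonsingular_conic Q) (uM : M \in unitmx) (hG : injective G).
Hypothesis uN : N \in unitmx.
Hypothesis frame_distinct :
  forall a b, a != b -> bracket (frame d e f a) (frame d e f b) != 0.
Hypothesis Gframe : forall l, G l = <[veronese (frame d e f l *m N) *m M]>%VS.

Notation fr := (frame d e f).
Notation n := (joubert d e f).

Lemma eq_joubertP i j : i \in SIX -> j \in SIX -> i != j ->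
  n i = n j <-> concurrent [seq (fr p.1, fr p.2) | p <- syntheme i j].
Proof.
move=> iS jS ij; have [s] := joubertB d e f iS jS ij.
have : size (syntheme i j) == 3.
  have H : all (fun i => all (fun j => (i != j) ==> (size (syntheme i j) == 3)) SIX) SIX.
    by vm_compute.
  exact: (implyP (allP (allP H i iS) j jS)).
case: (syntheme i j) => [|[a a'] [|[b b'] [|[c c'] [|? ?]]]] //= _ nij.
rewrite -[concurrent _]/(exists2 w : 'rV[K]_3, w != 0 & _) -involutionP.
have s0 : (-1) ^+ s * 2%:R != 0 :> K by rewrite mulf_neq0 ?signr_eq0 ?pnatr_eq0.
split=> [eij|z]; last by apply/eqP; rewrite -subr_eq0 nij z mulr0.
by apply: (mulfI s0); rewrite -nij eij subrr mulr0.
Qed.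

Lemma veronese_line_eq (u v : 'rV[K]_2) : u != 0 -> v != 0 ->
  <[veronese u *m M]>%VS = <[veronese v *m M]>%VS -> exists2 c, c != 0 & v = c *: u.
Proof.
move=> u0 v0 euv; apply: bracket_eq0 => //.
have h : veronese v *m M \in <[veronese u *m M]>%VS by rewrite euv memv_line.
have : veronese v *m M \in line (invmx M *m chord u u).
  by apply: subvP h; rewrite -memvE mem_chord // bracket_self mul0r.
by rewrite mem_chord // -expr2 sqrf_eq0 bracketC oppr_eq0 => /eqP.
Qed.

Lemma frame_mul_neq0 l : fr l *m N != 0.
Proof.
apply: contraNneq (frame_neq0 frame_distinct l) => z.
by rewrite -[fr l](mulmxK uN) z mul0mx.
Qed.

(** Two of the involutions of the model, read through the labelling, give two
    pairs of equal invariants with an index in common. *)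
Lemma tri_involutive_three_equal : tri_involutive M G -> three_equal n.
Proof.
move=> [p [p0 [N' [uN' eqG]]]].
pose q k := nth 0 (tri_involutive_model p) k.
have Gq k : (k < 6)%N -> exists l, G l = <[veronese (q k *m N') *m M]>%VS.
  move=> k6; have : <[quadratic_map M (q k *m N')]>%VS \in [seq G l | l <- letters].
    by rewrite eqG; apply/mapP; exists (q k) => //; apply: mem_nth.
  by case/mapP=> l _ ->; exists l.
have [l0 e0] := Gq 0%N isT; have [l1 e1] := Gq 1%N isT; have [l2 e2] := Gq 2%N isT.
have [l3 e3] := Gq 3%N isT; have [l4 e4] := Gq 4%N isT; have [l5 e5] := Gq 5%N isT.
pose s := [:: l0; l1; l2; l3; l4; l5].
have Gs k : (k < 6)%N -> G (nth A s k) = <[veronese (q k *m N') *m M]>%VS.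
  by case: k => [|[|[|[|[|[|k]]]]]].
have ls l : l \in s.
  have : G l \in [seq <[quadratic_map M (v *m N')]>%VS | v <- tri_involutive_model p].
    by rewrite -eqG; apply: map_f; case: l.
  case/mapP=> v /(nthP 0) [k k6 <-] el.
  have <- : nth A s k = l by apply: hG; rewrite Gs.
  exact: mem_nth.
have ps : perm_eq s letters.
  have us : uniq letters by [].
  rewrite perm_sym uniq_perm //; last by move=> l; rewrite ls; case: l.
  by apply: leq_size_uniq us _ _ => // l _; exact: ls.
have prop l : exists c, fr l = c *: (q (index l s) *m (N' *m invmx N)).
  have k6 : (index l s < 6)%N by have := ls l; rewrite -index_mem.
  have el : G l = <[veronese (q (index l s) *m N') *m M]>%VS.
    by rewrite -Gs // nth_index.
  have q0 : q (index l s) *m N' != 0.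
    apply: contraNneq (veronese_neq0 uM (frame_mul_neq0 l)) => z.
    have : veronese (fr l *m N) *m M \in G l by rewrite Gframe memv_line.
    rewrite el z -(scale0r (0 : 'rV[K]_2)) veroneseZ expr0n scale0r mul0mx.
    by case/vlineP=> c ->; rewrite scaler0.
  have := el; rewrite Gframe => /esym /(veronese_line_eq q0 (frame_mul_neq0 l)) [c _ ec].
  by exists c; rewrite -[fr l](mulmxK uN) ec -scalemxAl mulmxA.
have conc i j : matched s i j -> concurrent [seq (fr x.1, fr x.2) | x <- syntheme i j].
  case/hasP=> m hm /allP hall; apply: concurrent_sub (model_matching p (N' *m invmx N) hm) _.
  move=> _ /mapP [x xs ->] /=.
  have : contains m (index x.1 s) (index x.2 s) by apply: (hall (_, _)); apply: map_f.
  have [c1 ->] := prop x.1; have [c2 ->] := prop x.2; rewrite chordZ.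
  case/orP=> h; eexists; exists (c1 * c2); (split; first by apply: map_f h) => //=.
  by rewrite chordC.
have [i [j [k [u S mij mjk]]]] := matched_triple ps.
have [iS jS kS] : [/\ i \in SIX, j \in SIX & k \in SIX].
  by split; apply: S; rewrite !inE eqxx ?orbT.
have := u; rewrite /= !inE negb_or andbT => /andP [/andP [ij _] jk].
exists i, j, k; split=> //; first by apply/(eq_joubertP iS jS ij)/conc.
by apply/(eq_joubertP jS kS jk)/conc.
Qed.

(** Let [l1], ..., [l6] be the hexad of the two synthemes.  Once [l1], [l2], [l3]
    are moved to [0], [1], [oo], the two involutions leave one
    possibility for [l5] and [l6] in terms of [p = l4]. *)
Lemma three_equal_tri_involutive : three_equal n -> tri_involutive M G.
Proof.
move=> [i [j [k [u3 S nij njk]]]].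
have [iS jS kS] : [/\ i \in SIX, j \in SIX & k \in SIX].
  by split; apply: S; rewrite !inE eqxx ?orbT.
have := u3; rewrite /= !inE negb_or andbT => /andP [/andP [ij _] jk].
move/(eq_joubertP iS jS ij): nij => cij; move/(eq_joubertP jS kS jk): njk => cjk.
have [l1 [l2 [l3 [l4 [l5 [l6 [pl /= h]]]]]]] := triple_hexad u3 S.
case/and4P: h => h14 h25 h36 /and3P [h15 h26 h34].
have chordj a b s : ((a, b) \in s) || ((b, a) \in s) ->
    exists p, p \in [seq (fr p.1, fr p.2) | p <- s] /\ chord (fr a) (fr b) = chord p.1 p.2.
  by case/orP=> h; [exists (fr a, fr b)|exists (fr b, fr a)]; split=> /=;
    rewrite 1?chordC //; exact: (map_f (fun p : letter * letter => (fr p.1, fr p.2)) h).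
have inv a a' b b' c c' s : concurrent [seq (fr p.1, fr p.2) | p <- s] ->
    ((a, a') \in s) || ((a', a) \in s) -> ((b, b') \in s) || ((b', b) \in s) ->
    ((c, c') \in s) || ((c', c) \in s) ->
    involution (fr a) (fr a') (fr b) (fr b') (fr c) (fr c') = 0.
  move=> cs ha hb hc; apply/involutionP; apply: concurrent_sub cs _ => q.
  by rewrite !inE => /or3P [] /eqP -> /=;
    [have [x [xs ->]] := chordj _ _ _ ha|have [x [xs ->]] := chordj _ _ _ hb
    |have [x [xs ->]] := chordj _ _ _ hc]; exists x, 1; rewrite scale1r.
have ls l : l \in [:: l1; l2; l3; l4; l5; l6] by rewrite (perm_mem pl); case: l.
have dist := perm_uniq pl; rewrite /= !inE !negb_or -!andbA in dist.
have br a b : a != b -> bracket (fr a) (fr b) != 0 by exact: frame_distinct.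
case/and5P: dist => l12 l13 l14 l15 /and5P [l16 l23 l24 l25].
case/and5P=> l26 l34 l35 l36 /and4P [l45 l46 l56 _].
have l31 : l3 != l1 by rewrite eq_sym.
have l32 : l3 != l2 by rewrite eq_sym.
have [N1 uN1 [a3 [a1 [a2 [/and3P [a30 a10 a20] ea3 ea1 ea2]]]]] :=
  three_points (br _ _ l31) (br _ _ l32) (br _ _ l12).
have i1 := inv _ _ _ _ _ _ _ cij h14 h25 h36.
have i2 := inv _ _ _ _ _ _ _ cjk h15 h26 h34.
have D0 : \det N1 != 0 by move: uN1; rewrite unitmxE unitfE.
have coord l : exists u, fr l = u *m N1 by exists (fr l *m invmx N1); rewrite mulmxKV.
have [p e4] := coord l4; have [u e5] := coord l5; have [v e6] := coord l6.
have a123 : a1 * a2 * a3 != 0 by rewrite !mulf_neq0.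
move: i1 i2; rewrite ea1 ea2 ea3 e4 e5 e6 !involutionZ !involution_mul.
move/eqP; rewrite mulf_eq0 (negPf a123) mulf_eq0 expf_eq0 (negPf D0) => /eqP i1.
move/eqP; rewrite mulf_eq0 (negPf a123) mulf_eq0 expf_eq0 (negPf D0) => /eqP i2.
have nz l w : fr l = w *m N1 -> w != 0.
  by move=> ew; apply: contraNneq (frame_neq0 frame_distinct l) => w0; rewrite ew w0 mul0mx.
have pv : bracket p v != 0.
  by have := br _ _ l46; rewrite e4 e6 bracket_mul mulf_eq0 negb_or => /andP [].
have zv : bracket (hcoord 0 1) v != 0.
  have := br _ _ l16; rewrite ea1 e6 bracketZl bracket_mul !mulf_eq0 !negb_or.
  by case/and3P.
have [b5 b6] := second_orbit_points i1 i2 (nz _ _ e5) pv zv.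
have p0 := nz _ _ e4.
have h5 : hcoord (p 0 0 - p 0 1) (p 0 0) != 0.
  apply: contraNneq p0 => /rowP z; have := z 0; have := z 1; rewrite !mxE /= => z0.
  by rewrite z0 sub0r => /eqP; rewrite oppr_eq0 => /eqP z1; apply/eqP/rV2P; rewrite mxE.
have h6 : hcoord (p 0 1) (p 0 1 - p 0 0) != 0.
  apply: contraNneq p0 => /rowP z; have := z 1; have := z 0; rewrite !mxE /= => z0.
  by rewrite z0 sub0r => /eqP; rewrite oppr_eq0 => /eqP z1; apply/eqP/rV2P; rewrite mxE.
have [c5 c50 r5] := bracket_eq0 (nz _ _ e5) h5 b5.
have [c6 c60 r6] := bracket_eq0 (nz _ _ e6) h6 b6.
have same l (c : K) w : c != 0 -> fr l = c *: (w *m N1) ->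
    G l = <[quadratic_map M (w *m (N1 *m N))]>%VS.
  move=> c0 ew; rewrite Gframe ew -scalemxAl -mulmxA veroneseZ -scalemxAl.
  by rewrite vlineZ // expf_neq0.
exists p; split=> //; exists (N1 *m N); split; first by rewrite unitmx_mul uN1.
move=> P; rewrite -(perm_mem (perm_map G pl)) /tri_involutive_model /=.
rewrite (same l1 _ _ a10 ea1) (same l2 _ _ a20 ea2) (same l3 _ _ a30 ea3).
rewrite (same l4 1 p (oner_neq0 _)) ?scale1r //.
rewrite (same l5 c5^-1 (hcoord (p 0 0 - p 0 1) (p 0 0))) ?invr_eq0 //; last first.
  by rewrite r5 -scalemxAl scalerA mulVf // scale1r.
rewrite (same l6 c6^-1 (hcoord (p 0 1) (p 0 1 - p 0 0))) ?invr_eq0 //.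
by rewrite r6 -scalemxAl scalerA mulVf // scale1r.
Qed.

End Equivalence.

(** * The equivalence *)

Lemma tri_involutive_CSC (K : numFieldType) (Q M : 'M[K]_3)
    (G : letter -> {vspace 'rV[K]_3}) :
  nonsingular_conic Q -> conic_isomorphism Q M -> injective G ->
  (forall l, on_conic Q (G l)) -> tri_involutive M G <-> CSC Q G.
Proof.
move=> hQ hM hG hGQ.
have [d [e [f [N [uN fd Gl]]]]] := normal_form hQ hM hG hGQ.
have hSM : conic_isomorphism Q (sym2 N *m M).
  split; first by rewrite unitmx_mul sym2_unit //; case: hM.
  move=> v; have -> : quadratic_map (sym2 N *m M) v = quadratic_map M (v *m N).
    by rewrite /quadratic_map -!/(veronese _) veronese_mul mulmxA.
  by case: hM.
have GlS l : G l = <[veronese (frame d e f l) *m (sym2 N *m M)]>%VS.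
  by rewrite Gl veronese_mul mulmxA.
have [c c0 gS] := conic_gram hQ hSM.
have H := frame_hexahedral fd hQ hSM.1 c0 gS GlS.
split=> [tri | csc].
  apply: (three_equal_CSC hQ H).
  exact: (tri_involutive_three_equal hM.1 hG uN fd Gl tri).
apply: (three_equal_tri_involutive uN fd Gl).
exact: (CSC_three_equal hQ H csc).
Qed.

Theorem theorem1p1 (R : realType) (Q M : 'M[R[i]]_3)
    (G : letter -> {vspace 'rV[R[i]]_3})
    (hQ : nonsingular_conic Q) (hM : conic_isomorphism Q M)
    (hG : injective G) (hGQ : forall l, on_conic Q (G l)) :
  tri_involutive M G <-> CSC Q G.
Proof. exact: tri_involutive_CSC. Qed.
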